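(* Let $i,j$ be positive integers such that $N=i+j$ is even, and put $$R_{i+j}:=\binom{N}{i}\beta_N r_N .$$ Then the fractional parts of the points $$\left(\frac pq,\ R_{i+j}\,q^{i+j-2}s_{i,j}(p,q)\right),\qquad 0<p<q,\ \gcd(p,q)=1,$$ are equidistributed in $[0,1)^2$.
   Context: $B_m$ is the $m$-th Bernoulli number. $\bar B_m$ is the $m$-th periodic Bernoulli function: $\bar B_m(x)=B_m(x-\lfloor x\rfloor)$ with $B_m(\cdot)$ the Bernoulli polynomial, except $\bar B_1(x)=0$ for $x\in\mathbb Z$. The generalized Dedekind sum is $s_{i,j}(p,q)=\sum_{k=0}^{q-1}\bar B_i(k/q)\bar B_j(pk/q)$. For $B_k\neq0$, $\alpha_k/\beta_k$ denotes the reduced fraction of $B_k$ with $\beta_k>0$. The integer $r_N$ is the least common multiple of the denominators (in lowest terms) of the rational numbers $\beta_N\binom{N}{l+1}B_{l+1}B_{N-l-1}$, where $l$ runs over odd integers with $0\le l\le N-2$ (so $r_N=1$ if there are none). Equidistribution is in the sense of Weyl, with pairs $(p,q)$ ordered by increasing $q$: for every continuous function $\varphi$ on $(\mathbb R/\mathbb Z)^2$, the average of $\varphi$ over the points attached to the pairs $(p,q)$ with $0<p<q\le x$, $\gcd(p,q)=1$, tends to $\int_{(\mathbb R/\mathbb Z)^2}\varphi$ (Lebesgue measure) as $x\to\infty$. Equivalently, for every $\mathbf m\in\mathbb Z^2\setminus\{0\}$ the average of $\exp(2\pi i\,\mathbf m\cdot P)$ over these points $P$ tends to $0$ as $x\to\infty$.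 *)

(* Defs.v *)
From HB Require Import structures.
From mathcomp Require Import all_boot all_order all_algebra.
From mathcomp Require Import all_classical all_reals all_analysis.

Set Implicit Arguments.
Unset Strict Implicit.
Unset Printing Implicit Defensive.

Import Order.TTheory GRing.Theory Num.Theory.
Import numFieldNormedType.Exports.

Local Open Scope classical_set_scope.
Local Open Scope ring_scope.

(* The list B_0, ..., B_(n-1), computed from the recurrence
   \sum_(k <= m) 'C(m + 1, k) B_k = [m = 0]; hence B_1 = -1/2. *)
Fixpoint bernoulli_seq (n : nat) : seq rat :=
  if n is m.+1 then
    let s := bernoulli_seq m in
    rcons s (((m == 0)%N%:R - \sum_(k < m) 'C(m.+1, k)%:R * s`_k) / m.+1%:R)
  else [::].

Definition bernoulli_number (m : nat) : rat := (bernoulli_seq m.+1)`_m.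

Lemma size_bernoulli_seq n : size (bernoulli_seq n) = n.
Proof. by elim: n => //= n IHn; rewrite size_rcons IHn. Qed.

Lemma nth_bernoulli_seq n k :
  (k < n)%N -> (bernoulli_seq n)`_k = bernoulli_number k.
Proof.
elim: n => // n IHn; rewrite ltnS leq_eqVlt => /predU1P[-> //|lt_kn].
by rewrite /= nth_rcons size_bernoulli_seq lt_kn IHn.
Qed.

Lemma bernoulli_number_rec m :
  \sum_(k < m.+1) 'C(m.+1, k)%:R * bernoulli_number k = (m == 0)%N%:R.
Proof.
rewrite big_ord_recr /= binSn {2}/bernoulli_number /=.
rewrite nth_rcons size_bernoulli_seq ltnn eqxx.
rewrite mulrC divfK ?pnatr_eq0 // addrC.
under [X in _ - X]eq_bigr => k _ do rewrite nth_bernoulli_seq //.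
by rewrite subrK.
Qed.

Definition bernoulli_poly (m : nat) : {poly rat} :=
  \sum_(k < m.+1) ('C(m, k)%:R * bernoulli_number k) *: 'X^(m - k).

Definition fractional_part {R : archiRealFieldType} (x : R) : R :=
  x - (Num.floor x)%:~R.

Definition periodic_bernoulli {R : archiRealFieldType} (m : nat) (x : R) : R :=
  if (m == 1)%N && (x \is a Num.int) then 0
  else (map_poly ratr (bernoulli_poly m)).[fractional_part x].

Definition dedekind_sum {R : archiRealFieldType} (i j p q : nat) : R :=
  \sum_(0 <= k < q)
    periodic_bernoulli i (k%:R / q%:R) * periodic_bernoulli j ((p * k)%:R / q%:R).

(* denq is the positive denominator of the reduced fraction. *)
Definition rat_den (x : rat) : nat := `|denq x|%N.

Definition bernoulli_den (k : nat) : nat := rat_den (bernoulli_number k).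

(* For N >= 2 the bound l < N.-1 is l <= N - 2. *)
Definition lcm_den (N : nat) : nat :=
  \big[lcmn/1%N]_(0 <= l < N.-1 | odd l)
    rat_den ((bernoulli_den N)%:R * 'C(N, l.+1)%:R
             * bernoulli_number l.+1 * bernoulli_number (N - l - 1)).

Definition dedekind_scale (i j : nat) : nat :=
  ('C(i + j, i) * bernoulli_den (i + j) * lcm_den (i + j))%N.

Definition coprime_pairs (n : nat) : {set 'I_n.+1 * 'I_n.+1} :=
  [set z : 'I_n.+1 * 'I_n.+1 | (0 < z.1 < z.2)%N && coprime z.1 z.2]%SET.

(* Continuous functions on (R/Z)^2 are continuous functions on R^2 that are
   1-periodic in each variable. *)
Definition torus_function {R : realType} (phi : R * R -> R) : Prop :=
  [/\ continuous phi,
      forall x y, phi (x + 1, y) = phi (x, y)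
    & forall x y, phi (x, y + 1) = phi (x, y)].

Definition torus_integral {R : realType} (phi : R * R -> R) : R :=
  \int[(@lebesgue_measure R \x @lebesgue_measure R)%E]_(z in
    `[0, 1[ `*` `[0, 1[) phi z.

(* Since q is an integer, the bound q <= x only depends on the integer part
   of x, so the limit is taken along integers n. *)
Definition equidistributed {R : realType} (P : nat -> nat -> R * R) : Prop :=
  forall phi : R * R -> R, torus_function phi ->
    (\sum_(z in coprime_pairs n) phi (P z.1 z.2)) / #|coprime_pairs n|%:R
      @[n --> \oo] --> torus_integral phi.

(* Main.v *)
Require Import Defs.
From HB Require Import structures.
From mathcomp Require Import all_boot all_order all_algebra.
From mathcomp Require Import all_classical all_reals all_analysis.
From mathcomp Require Import measurable_realfun complex.
From mathcomp Require Import ring lra zify.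

(** Let N = i + j, let B_m be the Bernoulli numbers, write the reduced fraction
    of B_N as alpha / beta, let R be the scaling integer, s(p, q) the Dedekind
    sum and e(x) = exp(2 pi i x). By Weyl's criterion it suffices to show that,
    for each pair of integers (m1, m2) other than (0, 0), the average of
    e(m1 p / q + m2 R q^(N-2) s(p, q)) tends to 0.

    Arithmetic. Let q = l r, where l is a large prime that does not divide r.
    When p and p1 are prime to q and congruent modulo r, the difference
    R q^(N-2) (s(p, q) - s(p1, q)) equals z / l for an integer z such that
    N r z = R B_N (g(p) - g(p1)) modulo l, where g(x) = i x^j + j x^(-i)
    ([scaled_dedekind_sum_difference]). This is checked one prime v at a time:
    - if v does not divide q, because q^m (B_m(a / q) - B_m) is integral at v
      ([dsum_var_coprime]);
    - if v divides r, by an expansion to first order in p - p1. The first order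
      term is evaluated with the exponents (0, N), for which the sum does not
      depend on p ([dsum_var_dividing]);
    - if v = l, by an expansion to second order in q ([dsum_large]).
    About R it matters only that R is a nonzero multiple of 2 binomial(N, i),
    which holds because beta is even.

    Exponential sums. On a class of p modulo r the phase is therefore, up to a
    constant, the additive character of F_l at u h(p), where h is a fixed
    Laurent polynomial and u is the inverse of beta N r. Hence the sum over p is
    at most phi(r) |T(u)|, where T(u) is the sum of e(u h(x) / l) over x in
    F_l^* ([weyl_sum_local_bound]). No bound for an individual T(u) is needed:
    the sum over u of |T(u)|^2 is l times the number of solutions of
    h(x) = h(y), hence at most N l (l - 1), so that |T(u)| > d (l - 1) for a
    number of u that is bounded independently of l ([card_bad_expsum]).

    Density. The sum of the inverses of the primes l > K diverges, so by Turan's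
    second moment argument almost all q are divisible by a prime l in a suitable
    range ]K, L[. Rarely does l^2 divide q, and rarely is q / l in one of the
    few bad classes modulo l ([few_without_good_factor]). The trivial bound for
    the exceptional q and a lower bound of order n^2 for the number of pairs
    give [weyl_sum_small].

    Continuous functions. A continuous function on the torus is a uniform limit
    of trigonometric polynomials built from its values on a grid and the Fejer
    kernel ([fejer_mean_approx]). Their means are the grid averages of the
    function, which tend to its integral ([torus_integral_grid]). *)

Set Implicit Arguments.
Unset Strict Implicit.
Unset Printing Implicit Defensive.

Import Order.TTheory GRing.Theory Num.Theory.
Import numFieldNormedType.Exports.

Local Open Scope ring_scope.

(** * Rational numbers integral at n *)

(** The ring of rational numbers whose denominator is prime to n; for n a
    prime, these are the numbers that are integral at n. Congruences modulo c
    in this ring are stated as membership of (x - y) / c. *)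
Definition localized (n : nat) : {pred rat} := fun x => coprime n `|denq x|.

Lemma localizedP n x :
  reflect (exists2 d : nat, coprime n d & d%:R * x \is a Num.int)
          (x \in localized n).
Proof.
apply: (iffP idP) => [cx|[d cd /intrP[z dxz]]].
  exists `|denq x|%N => //.
  rewrite natr_absz (ger0_norm (denq_ge0 x)) mulrC -numqE; exact: intr_int.
have: (denq x %| (d%:Z * numq x))%Z.
  apply/dvdzP; exists z; apply: (intr_inj (R := rat)).
  by rewrite !intrM numqE -dxz mulrA.
rewrite Gauss_dvdzl; last by rewrite coprimezE coprime_sym coprime_num_den.
rewrite dvdzE /= => dd.
by rewrite unfold_in /localized; apply: coprime_dvdr dd cd.
Qed.

Lemma localized_subring n : subring_closed (localized n).
Proof.
split.
- by rewrite unfold_in /localized (denq_int 1) coprimen1.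
- move=> x y /localizedP[d cd dx] /localizedP[e ce ey].
  apply/localizedP; exists (d * e)%N; first by rewrite coprimeMr cd.
  have -> : (d * e)%:R * (x - y) = e%:R * (d%:R * x) - d%:R * (e%:R * y) :> rat.
    by rewrite natrM; ring.
  by apply: rpredB; apply: rpredM; rewrite ?natr_int.
- move=> x y /localizedP[d cd dx] /localizedP[e ce ey].
  apply/localizedP; exists (d * e)%N; first by rewrite coprimeMr cd.
  have -> : (d * e)%:R * (x * y) = (d%:R * x) * (e%:R * y) :> rat.
    by rewrite natrM; ring.
  by apply: rpredM.
Qed.

HB.instance Definition _ n :=
  GRing.isSubringClosed.Build rat (localized n) (localized_subring n).

Lemma localized_inv n d : coprime n d -> d%:R^-1 \in localized n.
Proof.
move=> cnd; case: (posnP d) => [->|d_gt0]; first by rewrite invr0 rpred0.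
by apply/localizedP; exists d; rewrite // divff ?rpred1 // pnatr_eq0 -lt0n.
Qed.

(** A rational number is an integer as soon as it is integral at every
    prime. *)
Lemma localized_int (x : rat) :
  (forall v, prime v -> x \in localized v) -> x \is a Num.int.
Proof.
move=> h; rewrite Qint_def -[denq x]gez0_abs ?denq_ge0 //.
case: (ltngtP `|denq x|%N 1) => [|lt1|->//].
  by rewrite ltnS leqn0 absz_eq0 (negPf (denq_neq0 x)).
have := h _ (pdiv_prime lt1); rewrite unfold_in /localized prime_coprime
  ?pdiv_prime //.
by rewrite pdiv_dvd.
Qed.

Lemma int_localized n (x : rat) : x \is a Num.int -> x \in localized n.
Proof. by move=> /intrP[z ->]; rewrite rpred_int. Qed.

Lemma localized_dvd v (z : int) : prime v ->
  z%:~R / v%:R \in localized v -> (v%:Z %| z)%Z.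
Proof.
move=> pv /localizedP[d cd /intrP[y dy]].
have v0 : v%:R != 0 :> rat by rewrite pnatr_eq0 -lt0n prime_gt0.
rewrite -(@Gauss_dvdzl _ _ d) ?coprimezE //.
apply/dvdzP; exists y; apply: (intr_inj (R := rat)).
by rewrite !intrM -dy; field.
Qed.

(** * Bernoulli numbers *)

Local Notation bern := bernoulli_number.

Lemma bern0 : bern 0 = 1.
Proof. by have := bernoulli_number_rec 0;
  rewrite big_ord_recl big_ord0 /= bin0 mul1r addr0. Qed.

Lemma bern1 : bern 1 = - 2^-1.
Proof.
have := bernoulli_number_rec 1; rewrite !big_ord_recl big_ord0 /= bin0 bin1
  bern0.
by move=> h; lra.
Qed.

(** The homogeneous Bernoulli polynomial q^m B_m(a / q), as a polynomial in q
    and a. *)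
Definition hbern (m : nat) (q a : rat) : rat :=
  \sum_(u < m.+1) 'C(m, u)%:R * bern u * q ^+ u * a ^+ (m - u).

Lemma hbern_scale m (q a : rat) : q != 0 ->
  hbern m q a = q ^+ m * (bernoulli_poly m).[a / q].
Proof.
move=> q0; rewrite /hbern /bernoulli_poly horner_sum mulr_sumr.
apply: eq_bigr => u _; rewrite hornerZ hornerXn.
rewrite [LHS]mulrC exprMn exprVn.
have -> : q ^+ m = q ^+ u * q ^+ (m - u)
  by rewrite -exprD subnKC // -ltnS ltn_ord.
have : q ^+ (m - u) != 0 by rewrite expf_neq0.
by move=> h; field.
Qed.

Lemma hbern0 m q : hbern m q 0 = bern m * q ^+ m.
Proof.
rewrite /hbern big_ord_recr /= subnn expr0 binn mul1r mulr1 big1 ?add0r //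
  => u _.
by rewrite expr0n subn_eq0 leqNgt ltn_ord mulr0.
Qed.

Lemma sum_bin_bern n :
  \sum_(u < n.+1) 'C(n, u)%:R * bern u = bern n + (n == 1)%N%:R.
Proof.
rewrite big_ord_recr /= binn mul1r addrC; congr (_ + _).
case: n => [|n]; first by rewrite big_ord0.
by rewrite bernoulli_number_rec.
Qed.

(** The difference equation B_m(x + 1) - B_m(x) = m x^(m-1), in homogeneous
    form. *)
Lemma hbern_shift m (q a : rat) :
  hbern m q (a + q) - hbern m q a = m%:R * q * a ^+ m.-1.
Proof.
have -> : hbern m q (a + q) = \sum_(u < m.+1) \sum_(v < m.+1)
    'C(m, v)%:R * a ^+ v * q ^+ (m - v) * ('C(m - v, u)%:R * bern u).
  apply: eq_bigr => u _; rewrite addrC exprDn mulr_sumr.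
  have um : (u <= m)%N by rewrite -ltnS.
  rewrite -(big_mkord xpredT (fun v => 'C(m, u)%:R * bern u * q ^+ u *
     (q ^+ (m - u - v) * a ^+ v *+ 'C(m - u, v)))).
  rewrite -(big_mkord xpredT (fun v => 'C(m, v)%:R * a ^+ v * q ^+ (m - v) *
     ('C(m - v, u)%:R * bern u))).
  rewrite [RHS](big_cat_nat (n := (m - u).+1)) //=; last by lia.
  rewrite [X in _ = _ + X]big_nat_cond [X in _ = _ + X]big1 ?addr0; last first.
    move=> v /andP[/andP[h1 h2] _]; rewrite (@bin_small (m - v)); last by lia.
    by rewrite mul0r mulr0.
  rewrite !big_nat; apply: eq_bigr => v /andP[_ hv].
  have -> : (m - v = u + (m - u - v))%N by lia.
  have /(congr1 (fun z => z%:R : rat)) : ('C(m, u) * 'C(m - u, v) =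
    'C(m, v) * 'C(u + (m - u - v), u))%N.
    have e1 := @bin_fact m u um.
    have hv' : (v <= m - u)%N by lia.
    have hvm : (v <= m)%N by lia.
    have e2 := @bin_fact (m - u)%N v hv'.
    have e3 := @bin_fact m v hvm.
    have e4 := @bin_fact (m - v) u ltac:(lia).
    have e5 : (m - v = u + (m - u - v))%N by lia.
    rewrite -e5.
    have e6 : (m - v - u = m - u - v)%N by lia.
    rewrite e6 in e4.
    have f0 k : (0 < k`!)%N := fact_gt0 k.
    apply/eqP; rewrite -(eqn_pmul2r (f0 u)) -(eqn_pmul2r (f0 v))
      -(eqn_pmul2r (f0 (m - u - v)%N)).
    apply/eqP; transitivity (m`!).
      by rewrite -e1 -e2; ring.
    by rewrite -e3 -e4; ring.
  rewrite !natrM => hC; rewrite exprD -mulr_natl.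
  transitivity ('C(m, u)%:R * 'C(m - u, v)%:R * bern u * q ^+ u
    * q ^+ (m - u - v) * a ^+ v); first by ring.
  by rewrite hC; ring.
rewrite exchange_big /=.
under eq_bigr => v _.
  rewrite -mulr_sumr.
  have -> : \sum_(i < m.+1) ('C(m - v, i)%:R * bern i) = bern (m - v)
    + (m - v == 1)%N%:R.
    rewrite -sum_bin_bern.
    rewrite -!(big_mkord xpredT (fun i => 'C(m - v, i)%:R * bern i)).
    rewrite [LHS](big_cat_nat (n := (m - v).+1)) //=; last by lia.
    rewrite [X in _ + X]big_nat_cond [X in _ + X]big1 ?addr0 //.
    by move=> u /andP[/andP[h1 _] _]; rewrite bin_small ?mul0r.
  rewrite mulrDr.
  over.
rewrite big_split /= [X in X + _ - _](_ : _ = hbern m q a).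
  rewrite addrC addKr.
  case: m => [|m]; first by rewrite big_ord_recl big_ord0 /= !mulr0 mul0r mul0r
    addr0.
  rewrite big_ord_recr /= subnn mulr0 addr0 big_ord_recr /= subSnn expr1 mulr1
    big1 ?add0r.
    by rewrite binSn; ring.
  move=> v _; have -> : (m.+1 - v == 1)%N = false by have := ltn_ord v; lia.
  by rewrite mulr0.
rewrite /hbern (reindex_inj rev_ord_inj) /=; apply: eq_bigr => u _.
have um : (u <= m)%N by rewrite -ltnS.
by rewrite !subSS subKn // bin_sub //; ring.
Qed.

Lemma faulhaber m n :
  \sum_(0 <= a < n) a%:R ^+ m =
  \sum_(u < m.+1) 'C(m, u)%:R * bern u * n%:R ^+ (m - u).+1 / (m - u).+1%:R.
Proof.
have h : m.+1%:R * (\sum_(0 <= a < n) a%:R ^+ m) = hbern m.+1 1 n%:R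
  - hbern m.+1 1 0.
  elim: n => [|n IH]; first by rewrite big_nil mulr0 subrr.
  rewrite big_nat_recr //= mulrDr IH -(natr1 n).
  by have /eqP := hbern_shift m.+1 1 n%:R; rewrite subr_eq => /eqP ->; ring.
have m0 : m.+1%:R != 0 :> rat by rewrite pnatr_eq0.
apply: (mulfI m0); rewrite h hbern0 expr1n mulr1 /hbern big_ord_recr /=.
rewrite subnn binn expr1n expr0 !mulr1 mul1r addrK mulr_sumr;
  apply: eq_bigr => u _.
have um : (u <= m)%N by rewrite -ltnS.
rewrite expr1n mulr1 subSn //.
have /(congr1 (fun z => z%:R : rat)) := mul_bin_down m.+1 u.
rewrite !natrM /= subSn // => hC.
have mu0 : (m - u).+1%:R != 0 :> rat by rewrite pnatr_eq0.
apply: (mulfI mu0);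
  transitivity ((m - u).+1%:R * 'C(m.+1, u)%:R * (bern u * n%:R ^+ (m - u).+1)).
  by ring.
by rewrite -hC; move: mu0; move: (m - u).+1%:R => c c0; field.
Qed.

Lemma localized_prime_power v k : prime v ->
  v%:R ^+ k / k.+1%:R \in localized v.
Proof.
move=> pv; have [d cd ed] := pfactor_coprime pv (ltn0Sn k).
have le : (logn v k.+1 <= k)%N.
  rewrite -ltnS; apply: (leq_trans (ltn_expl _ (prime_gt1 pv))).
  by apply: dvdn_leq => //; apply: pfactor_dvdnn.
have v0 : v%:R != 0 :> rat by rewrite pnatr_eq0 -lt0n prime_gt0.
have -> : v%:R ^+ k / k.+1%:R = v%:R ^+ (k - logn v k.+1) * d%:R^-1 :> rat.
  rewrite {1}ed natrM natrX -{1}(subnK le) exprD invfM.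
  by rewrite mulrACA mulfV ?mulr1 // expf_neq0.
by apply: rpredM; [rewrite rpredX // rpred_nat | exact: localized_inv].
Qed.

Lemma bern_faulhaber v m :
  v%:R * bern m = \sum_(0 <= a < v) a%:R ^+ m -
    \sum_(u < m) 'C(m, u)%:R * bern u * v%:R ^+ (m - u).+1 / (m - u).+1%:R.
Proof.
rewrite faulhaber [X in X - _]big_ord_recr /= subnn binn expr1 divr1 mul1r.
by rewrite [RHS]addrC addKr mulrC.
Qed.

(** The part of the von Staudt-Clausen theorem that v B_m is integral at v, by
    induction on Faulhaber's formula for the sum of a^m over a < v. *)
Lemma bern_localized v m : prime v -> v%:R * bern m \in localized v.
Proof.
move=> pv; elim/ltn_ind: m => m IH.
rewrite bern_faulhaber.
apply: rpredB; first by apply: rpred_sum => a _; rewrite rpredX // rpred_nat.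
apply: rpred_sum => u _.
have -> : 'C(m, u)%:R * bern u * v%:R ^+ (m - u).+1 / (m - u).+1%:R =
  'C(m, u)%:R * (v%:R * bern u) * (v%:R ^+ (m - u) / (m - u).+1%:R) :> rat.
  by rewrite exprS; ring.
by apply: rpredM;
  [apply: rpredM;
    [exact: rpred_nat | exact: IH] | exact: localized_prime_power].
Qed.

Lemma bern_localized_large l m : prime l -> (m.+1 < l)%N ->
  bern m \in localized l.
Proof.
move=> pl; elim/ltn_ind: m => m IH ml.
have m0 : m.+1%:R != 0 :> rat by rewrite pnatr_eq0.
have -> : bern m = ((m == 0)%N%:R - \sum_(k < m) 'C(m.+1, k)%:R * bern k)
  * m.+1%:R^-1.
  apply: (mulIf m0); rewrite mulfVK // -bernoulli_number_rec big_ord_recr /=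
    binSn.
  by rewrite addrC addrK mulrC.
apply: rpredM; last by apply: localized_inv; rewrite prime_coprime // gtnNdvd.
apply: rpredB; first exact: rpred_nat.
apply: rpred_sum => k _; apply: rpredM; first exact: rpred_nat.
by apply: IH => //; have := ltn_ord k; lia.
Qed.

Lemma localized_prime_power2 k : (1 < k)%N ->
  2^-1 * (2 ^+ k / k.+1%:R) \in localized 2.
Proof.
move=> k1; have [d cd ed] := pfactor_coprime (isT : prime 2) (ltn0Sn k).
have le : (logn 2 k.+1 <= k.-1)%N.
  rewrite leqNgt; apply/negP => lt.
  have : (2 ^ k <= k.+1)%N.
    apply: dvdn_leq => //; apply: dvdn_trans (pfactor_dvdnn 2 k.+1).
    by apply: dvdn_exp2l; lia.
  by case: k k1 {lt ed cd} => [|[|k]] // _; rewrite leqNgt !expnS; have :=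
    ltn_expl k (isT : 1 < 2)%N; lia.
have -> : 2^-1 * (2 ^+ k / k.+1%:R) = 2 ^+ (k.-1 - logn 2 k.+1) * d%:R^-1
  :> rat.
  have e2 : (2 : rat) ^+ k = 2 * (2 ^+ (k.-1 - logn 2 k.+1) * 2 ^+ logn 2 k.+1).
    by rewrite -exprD subnK // -exprS prednK // (ltn_trans _ k1).
  have v0 : (2 : rat) ^+ logn 2 k.+1 != 0 by rewrite expf_neq0.
  have d0 : (d%:R : rat) != 0.
    by rewrite pnatr_eq0; apply: contraTneq cd => ->.
  rewrite e2 {3}ed natrM natrX.
  by field; rewrite v0 d0.
by apply: rpredM; [rewrite rpredX // rpred_nat | exact: localized_inv].
Qed.

(** At the prime 2, B_N is half an odd number when N is even and positive. *)
Lemma bern_even_sub_half N : (0 < N)%N -> ~~ odd N ->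
  bern N - 2^-1 \in localized 2.
Proof.
move=> N0 No; have p2 : prime 2 by [].
have -> : bern N - 2^-1 = 2^-1 * (2 * bern N - 1) by field.
(* Faulhaber's formula for 0^N + 1^N = 1; it remains to see that half of each
   lower order term is integral at 2. *)
rewrite (bern_faulhaber 2) big_nat_recr // big_nat1 /= expr0n expr1n.
rewrite (gtn_eqF N0) add0r addrC addKr mulrN mulr_sumr rpredN.
apply: rpred_sum => u _; have uN := ltn_ord u.
have -> : 2^-1 * ('C(N, u)%:R * bern u * 2%:R ^+ (N - u).+1 / (N - u).+1%:R)
  = 'C(N, u)%:R * (2%:R * bern u) * (2^-1 * (2 ^+ (N - u) / (N - u).+1%:R))
    :> rat.
  by rewrite exprS; ring.
have [h|h] := ltnP 1 (N - u).
  apply: rpredM; last exact: localized_prime_power2.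
  by apply: rpredM; [exact: rpred_nat | exact: bern_localized].
(* The term u = N - 1 is half of an integral number multiplied by N, and N is
   even. *)
have eu : nat_of_ord u = N.-1 by lia.
have -> : (N - u = 1)%N by lia.
rewrite eu -bin_sub; last by lia.
have -> : (N - N.-1 = 1)%N by lia.
rewrite bin1 expr1 divff // mulr1.
rewrite [X in X * _]mulrC -mulrA; apply: rpredM; first exact: bern_localized.
have -> : N = (N./2 * 2)%N by have := odd_double_half N;
  rewrite (negPf No) -muln2; lia.
by rewrite natrM mulfK // rpred_nat.
Qed.

Lemma bernoulli_den_even N : (0 < N)%N -> ~~ odd N -> (2 %| bernoulli_den N)%N.
Proof.
move=> N0 No; apply: contraT => h2.
have h : bern N \in localized 2 by rewrite unfold_in /localized prime_coprime.
have : (2%:R : rat)^-1 \in localized 2.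
  have -> : (2%:R : rat)^-1 = bern N - (bern N - 2^-1) by field.
  by rewrite rpredB // bern_even_sub_half.
by rewrite unfold_in /localized -[2%:R]/(2%:~R) denqVz.
Qed.

Lemma bern_even_neq0 N : (0 < N)%N -> ~~ odd N -> bern N != 0.
Proof.
move=> N0 No; apply/eqP => h; have := bernoulli_den_even N0 No.
by rewrite /bernoulli_den /rat_den h.
Qed.

(** Taylor's formula for x^n with an integral second order remainder. *)
Lemma taylor2_int n (x d : rat) : x \is a Num.int -> d \is a Num.int ->
  exists2 w : rat, w \is a Num.int & (x + d) ^+ n = x ^+ n + n%:R * x ^+ n.-1
    * d + d ^+ 2 * w.
Proof.
move=> xi di; elim: n => [|n [w wi IH]].
  by exists 0; rewrite ?rpred0 // !expr0; ring.
exists (x * w + n%:R * x ^+ n.-1 + d * w).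
  by rewrite !(rpredD, rpredM, rpredX) // natr_int.
rewrite exprS IH -natr1 /=.
have -> : n%:R * x ^+ n.-1 = (if n is k.+1 then n%:R * x ^+ k else 0)
  by case: (n) => //; rewrite mul0r.
by case: n {IH} => [|n]; rewrite ?exprS; ring.
Qed.

Lemma bern_mul_localized v q u : prime v -> (v %| q)%N ->
  bern u * q%:R ^+ u \in localized v.
Proof.
move=> pv /dvdnP[c ->]; case: u => [|u];
  first by rewrite bern0 expr0 mulr1 rpred1.
rewrite exprS natrM.
have -> : bern u.+1 * (c%:R * v%:R * (c%:R * v%:R) ^+ u) =
  (v%:R * bern u.+1) * (c%:R * (c%:R * v%:R) ^+ u) :> rat by ring.
by apply: rpredM;
  [exact: bern_localized | rewrite !(rpredM, rpredX) // rpred_nat].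
Qed.

(** At a prime factor of q the number q^(u-1) B_u is integral up to a factor 2,
    which is needed only for u = 1. *)
Lemma bern_mul_pred_localized v q u : prime v -> (v %| q)%N -> (0 < u)%N ->
  2 * (bern u * q%:R ^+ u.-1) \in localized v.
Proof.
move=> pv /dvdnP[c ->]; case: u => [|[|u]] // _ /=.
  by rewrite expr0 mulr1 bern1 mulrN mulfV // rpredN rpred1.
rewrite exprS natrM.
have -> : 2 * (bern u.+2 * (c%:R * v%:R * (c%:R * v%:R) ^+ u)) =
  (v%:R * bern u.+2) * (2%:R * (c%:R * (c%:R * v%:R) ^+ u)) :> rat by ring.
by apply: rpredM;
  [exact: bern_localized | rewrite !(rpredM, rpredX) // rpred_nat].
Qed.

Lemma hbern_localized v q m (a : rat) : prime v -> (v %| q)%N ->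
  a \is a Num.int ->
  hbern m q%:R a \in localized v.
Proof.
move=> pv vq ai; apply: rpred_sum => u _.
apply: rpredM; last by rewrite rpredX // int_localized.
by rewrite -mulrA rpredM ?rpred_nat // bern_mul_localized.
Qed.

(** Modulo q, and up to a factor 2, the homogeneous Bernoulli polynomial is its
    leading term a^m. *)
Lemma hbern_leading v q m (a : rat) : prime v -> (v %| q)%N -> (0 < q)%N ->
  a \is a Num.int ->
  2 * (hbern m q%:R a - a ^+ m) / q%:R \in localized v.
Proof.
move=> pv vq q0 ai; rewrite /hbern big_ord_recl /= bin0 bern0 ?expr0 !mul1r
  subn0.
rewrite addrC addKr mulr_sumr mulr_suml; apply: rpred_sum => u _.
have q0' : q%:R != 0 :> rat by rewrite pnatr_eq0 -lt0n.
rewrite /bump /= add1n.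
have -> : 2 * ('C(m, u.+1)%:R * bern u.+1 * q%:R ^+ u.+1 * a ^+ (m - u.+1))
  / q%:R =
   'C(m, u.+1)%:R * (2 * (bern u.+1 * q%:R ^+ u.+1.-1)) * a ^+ (m - u.+1)
     :> rat.
  by rewrite exprS /=; field.
apply: rpredM; last by rewrite rpredX // int_localized.
by apply: rpredM; [exact: rpred_nat | exact: bern_mul_pred_localized].
Qed.

(** First order Taylor formula for the homogeneous Bernoulli polynomial, modulo
    r^2 for a divisor r of q. *)
Lemma hbern_diff v r q m (b d : rat) : prime v -> (v %| q)%N -> (r %| q)%N ->
  (0 < q)%N ->
  b \is a Num.int -> d \is a Num.int ->
  (2 * (hbern m q%:R (b + r%:R * d) - hbern m q%:R b)
    - 2 * m%:R * b ^+ m.-1 * (r%:R * d)) / r%:R ^+ 2 \in localized v.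
Proof.
move=> pv vq /dvdnP[c qE] q0 bi di.
have r0 : r%:R != 0 :> rat.
  by rewrite pnatr_eq0; apply: contraTneq q0; rewrite qE => ->; rewrite muln0.
have rd : r%:R * d \is a Num.int by rewrite rpredM // natr_int.
rewrite /hbern -sumrB big_ord_recl /= bin0 bern0 ?expr0 !mul1r subn0.
have [w wi ->] := taylor2_int m bi rd.
set S := \sum_(i < m) _.
have -> : (2 * (b ^+ m + m%:R * b ^+ m.-1 * (r%:R * d) + (r%:R * d) ^+ 2 * w
  - b ^+ m + S) -
   2 * m%:R * b ^+ m.-1 * (r%:R * d)) / r%:R ^+ 2 = 2 * d ^+ 2 * w
     + 2 * S / r%:R ^+ 2.
  by field.
apply: rpredD; first by apply: int_localized;
  rewrite !(rpredM, rpredX) // natr_int.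
rewrite mulr_sumr mulr_suml; apply: rpred_sum => u _.
rewrite /bump /= add1n.
have [w' wi' ->] := taylor2_int (m - u.+1) bi rd.
set x := 'C(_, _)%:R; set n := (m - u.+1)%N.
have -> : 2 * (x * bern u.+1 * q%:R ^+ u.+1
  * (b ^+ n + n%:R * b ^+ n.-1 * (r%:R * d) + (r%:R * d) ^+ 2 * w') -
   x * bern u.+1 * q%:R ^+ u.+1 * b ^+ n) / r%:R ^+ 2 =
   x * (2 * (bern u.+1 * q%:R ^+ u.+1.-1))
     * (c%:R * (n%:R * b ^+ n.-1 * d + r%:R * d ^+ 2 * w')).
  have -> : q%:R ^+ u.+1 = c%:R * r%:R * q%:R ^+ u.+1.-1 :> rat.
    by rewrite exprS {1}qE natrM.
  by field.
apply: rpredM; last by apply: int_localized;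
  rewrite !(rpredM, rpredX, rpredD) // natr_int.
by apply: rpredM; [exact: rpred_nat | exact: bern_mul_pred_localized].
Qed.

Lemma hbern_shift_int m q (a : rat) c : a \is a Num.int ->
  hbern m q%:R (a + c%:R * q%:R) - hbern m q%:R a \is a Num.int.
Proof.
move=> ai; elim: c => [|c IH]; first by rewrite mul0r addr0 subrr rpred0.
have -> : a + c.+1%:R * q%:R = (a + c%:R * q%:R) + q%:R by rewrite -natr1; ring.
rewrite -(subrK (hbern m q%:R (a + c%:R * q%:R)) (hbern _ _ (_ + q%:R)))
  hbern_shift -addrA.
by rewrite rpredD // !(rpredM, rpredX, rpredD) // natr_int.
Qed.

(** The number q^m (B_m(a / q) - B_m) is integral at the primes that do not
    divide q. *)
Lemma hbern_sub0_localized v q m a : prime v -> ~~ (v %| q)%N ->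
  hbern m q%:R a%:R - hbern m q%:R 0 \in localized v.
Proof.
move=> pv vq.
(* Replacing a by a + c q changes the value by an integer; c is chosen so that
   v divides a + c q. *)
have [c vc] : exists c, (v %| a + c * q)%N.
  have cvq : coprime v q by rewrite prime_coprime.
  pose x := (chinese v q 0 a + v * q * a)%N.
  have q0 : (0 < q)%N by case: (q) vq => //; rewrite dvdn0.
  have ax : (a <= x)%N.
    by rewrite /x -[X in (X <= _)%N]add0n leq_add // leq_pmull // muln_gt0
      prime_gt0.
  have : (q %| x - a)%N.
    by rewrite -eqn_mod_dvd // /x addnC mulnAC modnMDl chinese_modr.
  case/dvdnP => c hc; exists c; rewrite -hc subnKC //.
  have h1 : (v %| chinese v q 0 a)%N by rewrite /dvdn chinese_modl // mod0n.
  by rewrite /x -mulnA (dvdn_add h1) // dvdn_mulr.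
have /int_localized h := hbern_shift_int m q c (natr_int _ a).
rewrite -[hbern m q%:R a%:R](subrK (hbern m q%:R (a%:R + c%:R * q%:R))) -addrA.
apply: rpredD; first by rewrite -opprB rpredN; apply: h.
rewrite hbern0 /hbern big_ord_recr /= subnn binn expr0 mul1r mulr1 addrK.
apply: rpred_sum => u _; rewrite -natrM -natrD.
case/dvdnP: vc => e ->.
have -> : (m - u = (m - u).-1.+1)%N by have := ltn_ord u; lia.
rewrite exprS natrM.
have -> : 'C(m, u)%:R * bern u * q%:R ^+ u
  * (e%:R * v%:R * (e%:R * v%:R) ^+ (m - u).-1) =
  (v%:R * bern u) * ('C(m, u)%:R * q%:R ^+ u * e%:R
    * (e%:R * v%:R) ^+ (m - u).-1) :> rat by ring.
by apply: rpredM;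
  [exact: bern_localized | rewrite !(rpredM, rpredX) // rpred_nat].
Qed.

(** * Variation of the Dedekind sum with p *)

(** The Dedekind sum multiplied by q^(i+j), in homogeneous Bernoulli
    polynomials; the convention is B_1(0) = -1/2, without the modification of
    the periodic function at the integers. *)
Definition dsum (i j p q : nat) : rat :=
  \sum_(0 <= a < q) hbern i q%:R a%:R * hbern j q%:R ((p * a) %% q)%:R.

Lemma sum_mul_mod (V : nmodType) (F : nat -> V) p q : coprime p q ->
  \sum_(0 <= a < q) F ((p * a) %% q)%N = \sum_(0 <= a < q) F a.
Proof.
move=> cpq; have [->|q0] := posnP q; first by rewrite !big_nil.
case: q q0 cpq => // q _ cpq.
rewrite !big_mkord.
pose h (a : 'I_q.+1) : 'I_q.+1 := inord ((p * a) %% q.+1).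
have hE a : h a = ((p * a) %% q.+1)%N :> nat by rewrite inordK // ltn_pmod.
rewrite [RHS](reindex_inj (h := h)); first by apply: eq_bigr => a _; rewrite hE.
move=> a b /(congr1 val) /=; rewrite !hE => /eqP.
wlog ab : a b / (a <= b)%N => [hw|].
  case/orP: (leq_total a b) => [ab|ba]; first exact: hw.
  by rewrite eq_sym => /(hw b a ba) ->.
rewrite eq_sym eqn_mod_dvd ?leq_mul2l ?ab ?orbT // -mulnBr Gauss_dvdr
  1?coprime_sym // => dv.
apply/val_inj => /=; apply/eqP; rewrite eqn_leq ab /= -subn_eq0.
case: posnP => // b0; have := dvdn_leq b0 dv.
by have := ltn_ord b; lia.
Qed.

Lemma dsum0 n p q : coprime p q ->
  dsum 0 n p q = \sum_(0 <= a < q) hbern n q%:R a%:R.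
Proof.
move=> cpq; rewrite -(sum_mul_mod (fun a => hbern n q%:R a%:R) cpq).
apply: eq_bigr => a _; rewrite {1}/hbern big_ord_recl big_ord0 /= bin0 bern0
  !expr0.
by rewrite ?subn0 ?expr0 ?mulr1 ?addr0 ?mul1r.
Qed.

Lemma modn_nat_sub (p a q : nat) :
  ((p * a) %% q)%:R = p%:R * a%:R - q%:R * ((p * a) %/ q)%:R :> rat.
Proof. by rewrite -natrM {2}(divn_eq (p * a) q) natrD natrM; ring. Qed.

(** The sum that governs the variation of dsum between p and p1, to first
    order. *)
Definition dvar n p p1 q : rat :=
  \sum_(0 <= a < q) a%:R ^+ n.-1 * (((p * a) %% q)%:R - ((p1 * a) %% q)%:R).

Lemma modn_mul_diff (p p1 a q r c : nat) : q = (c * r)%N -> (0 < q)%N ->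
  p = p1 %[mod r] ->
  (((p * a) %% q)%:R - ((p1 * a) %% q)%:R) / r%:R \is a @Num.int rat.
Proof.
move=> qE q0 pp1.
have r0 : r%:R != 0 :> rat.
  by rewrite pnatr_eq0; apply: contraTneq q0; rewrite qE => ->; rewrite muln0.
have [z hz] : exists z : int, p%:R - p1%:R = z%:~R * r%:R :> rat.
  have : (r%:Z %| p%:Z - p1%:Z)%Z.
    by rewrite -eqz_mod_dvd; apply/eqP; rewrite !modz_nat pp1.
  by case/dvdzP => z hz; exists z;
    rewrite -[p%:R]/(p%:Z%:~R) -[p1%:R]/(p1%:Z%:~R) -intrB hz intrM.
rewrite !modn_nat_sub.
have -> : (p%:R * a%:R - q%:R * (p * a %/ q)%:R
  - (p1%:R * a%:R - q%:R * (p1 * a %/ q)%:R)) / r%:R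
  = z%:~R * a%:R - c%:R * (p * a %/ q)%:R + c%:R * (p1 * a %/ q)%:R :> rat.
  transitivity (((p%:R - p1%:R) * a%:R - q%:R * (p * a %/ q)%:R
    + q%:R * (p1 * a %/ q)%:R) / r%:R : rat).
    by congr (_ / _); ring.
  by rewrite hz qE natrM; field.
by rewrite !(rpredB, rpredD, rpredM) // ?natr_int ?intr_int.
Qed.

Lemma dsum_var_first_order v c r i j p p1 : prime v -> (v %| r)%N ->
  (0 < c * r)%N ->
  (0 < j)%N -> p = p1 %[mod r] ->
  (2 * (dsum i j p (c * r) - dsum i j p1 (c * r))
   - 2 * j%:R * p1%:R ^+ j.-1 * dvar (i + j) p p1 (c * r)) / r%:R ^+ 2
     \in localized v.
Proof.
move=> pv vr q0 j0 pp1; set q := (c * r)%N.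
have vq : (v %| q)%N by rewrite dvdn_mull.
have r0 : r%:R != 0 :> rat.
  by rewrite pnatr_eq0; apply: contraTneq q0 => ->; rewrite muln0.
have q0' : q%:R != 0 :> rat by rewrite pnatr_eq0 -lt0n.
rewrite /dsum /dvar -sumrB !mulr_sumr -sumrB mulr_suml; apply: rpred_sum => a _.
set b' := ((p * a) %% q)%:R; set b := ((p1 * a) %% q)%:R.
have Gi := modn_mul_diff a (erefl q) q0 pp1.
rewrite -/b -/b' in Gi; set G := _ / _ in Gi.
have b'E : b' = b + r%:R * G by rewrite /G; field.
have hE := hbern_diff j pv vq (dvdn_mull c (dvdnn r)) q0
  (natr_int _ ((p1 * a) %% q)) Gi.
rewrite -/b -b'E in hE.
have hH := hbern_leading i pv vq q0 (natr_int _ a).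
have hB := hbern_localized i pv vq (natr_int _ a).
set E := _ / _ in hE; set H := _ / _ in hH.
have [w wi hw] : exists2 w : rat, w \is a Num.int & b ^+ j.-1 =
  (p1%:R * a%:R) ^+ j.-1 + q%:R * w.
  have fi : - (q%:R * ((p1 * a) %/ q)%:R) \is a @Num.int rat
    by rewrite rpredN rpredM // natr_int.
  have [w wi hw] := taylor2_int j.-1 (natr_int _ (p1 * a)) fi.
  exists (- (j.-1%:R * (p1 * a)%:R ^+ j.-1.-1 * ((p1 * a) %/ q)%:R)
    + q%:R * ((p1 * a) %/ q)%:R ^+ 2 * w).
    by rewrite !(rpredB, rpredD, rpredN, rpredM, rpredX) // natr_int.
  by rewrite /b modn_nat_sub -natrM hw; ring.
rewrite -/b'.
have -> : (2 * (hbern i q%:R a%:R * hbern j q%:R b' - hbern i q%:R a%:R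
  * hbern j q%:R b) -
   2 * j%:R * p1%:R ^+ j.-1 * (a%:R ^+ (i + j).-1 * (b' - b))) / r%:R ^+ 2 =
  hbern i q%:R a%:R * E + j%:R * G * c%:R * H * b ^+ j.-1 + 2 * j%:R * G
    * a%:R ^+ i * c%:R * w.
  have -> : (i + j).-1 = (i + j.-1)%N by rewrite -[in LHS](prednK j0) addnS.
  rewrite /E /H b'E.
  have qE : q%:R = c%:R * r%:R :> rat by rewrite -natrM.
  have c0 : c%:R != 0 :> rat by apply: contraNneq q0'; rewrite qE => ->;
    rewrite mul0r.
  move: hw; rewrite qE => -> ; rewrite exprMn exprD.
  by field; rewrite r0 c0.
have wl := int_localized v wi.
have Gl := int_localized v Gi.
have n1 n := rpred_nat (localized v) n.
have bl : b \in localized v := n1 _.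
clearbody E H G b.
by rewrite !(rpredD, rpredM, rpredX) ?n1 ?rpred1.
Qed.

(** Integrality of the variation of dsum at a prime factor v of r, for p and p1
    congruent modulo r. *)
Lemma dsum_var_dividing v c r i j p p1 : prime v -> (v %| r)%N ->
  (0 < c * r)%N ->
  (0 < j)%N -> p = p1 %[mod r] -> coprime p (c * r) -> coprime p1 (c * r) ->
  2 * 'C(i + j, i)%:R * (dsum i j p (c * r) - dsum i j p1 (c * r)) / r%:R ^+ 2
    \in localized v.
Proof.
move=> pv vr q0 j0 pp1 cp cp1.
have r0 : r%:R != 0 :> rat.
  by rewrite pnatr_eq0; apply: contraTneq q0 => ->; rewrite muln0.
have vp1 : coprime v p1.
  by rewrite coprime_sym; apply: coprime_dvdr cp1; rewrite dvdn_mull.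
have p10 : p1%:R != 0 :> rat.
  by rewrite pnatr_eq0; apply: contraTneq vp1 => ->;
    rewrite /coprime gcdn0 gtn_eqF // prime_gt1.
have h1 := dsum_var_first_order i pv vr q0 j0 pp1.
have ij0 : (0 < i + j)%N by rewrite addn_gt0 j0 orbT.
(* For the exponents (0, i + j) the sum does not depend on p; this evaluates
   the common first order term dvar. *)
have h2 := dsum_var_first_order 0 pv vr q0 ij0 pp1.
rewrite !dsum0 // subrr mulr0 add0r add0n in h2.
set X := dsum i j p _ - _ in h1 *; set T := dvar _ _ _ _ in h1 h2.
have -> : 2 * 'C(i + j, i)%:R * X / r%:R ^+ 2 =
  'C(i + j, i)%:R * ((2 * X - 2 * j%:R * p1%:R ^+ j.-1 * T) / r%:R ^+ 2)
  - 'C((i + j).-1, i)%:R * (- (2 * (i + j)%:R * p1%:R ^+ (i + j).-1 * T)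
    / r%:R ^+ 2) * (p1 ^ i)%:R^-1.
  have /(congr1 (fun z => z%:R : rat)) := mul_bin_down (i + j) i.
  rewrite addKn !natrM natrX => hC.
  have -> : (i + j).-1 = (j.-1 + i)%N by lia.
  rewrite exprD.
  have pi0 : p1%:R ^+ i != 0 :> rat by rewrite expf_neq0.
  transitivity ('C(i + j, i)%:R * ((2 * X - 2 * j%:R * p1%:R ^+ j.-1 * T)
    / r%:R ^+ 2)
    + (j%:R * 'C(i + j, i)%:R) * 2 * p1%:R ^+ j.-1 * T / r%:R ^+ 2);
      first by field.
  rewrite -hC; have -> : (i + j).-1 = (j.-1 + i)%N by lia.
  by field; rewrite r0 pi0.
apply: rpredB; first by rewrite rpredM // rpred_nat.
apply: rpredM; first by rewrite rpredM // rpred_nat.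
by apply: localized_inv; rewrite coprimeXr.
Qed.

(** Integrality of the variation of dsum at a prime that does not divide q. *)
Lemma dsum_var_coprime v q i j p p1 : prime v -> ~~ (v %| q)%N ->
  coprime p q -> coprime p1 q ->
  dsum i j p q - dsum i j p1 q \in localized v.
Proof.
move=> pv vq cp cp1.
(* As multiplication by p permutes the residues, the constant hbern i q 0 can
   be subtracted from the first factor. *)
have -> : dsum i j p q - dsum i j p1 q = \sum_(0 <= a < q)
   (hbern i q%:R a%:R - hbern i q%:R 0) *
   ((hbern j q%:R ((p * a) %% q)%:R - hbern j q%:R 0)
     - (hbern j q%:R ((p1 * a) %% q)%:R - hbern j q%:R 0)).
  pose F (a : nat) := hbern j q%:R a%:R.
  have h : \sum_(0 <= a < q) (hbern i q%:R 0
    * (F ((p * a) %% q)%N - F ((p1 * a) %% q)%N)) = 0.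
    by rewrite -mulr_sumr sumrB !sum_mul_mod // subrr mulr0.
  rewrite /dsum -[LHS]subr0 -[X in _ - X = _]h -!sumrB; apply: eq_bigr => a _;
    rewrite /F; ring.
apply: rpred_sum => a _; apply: rpredM; first exact: hbern_sub0_localized.
by apply: rpredB; apply: hbern_sub0_localized.
Qed.

Lemma hbern_second_order l q m (a : rat) : prime l -> (m.+1 < l)%N ->
  (0 < q)%N -> a \is a Num.int ->
  (hbern m q%:R a - (a ^+ m - 2^-1 * m%:R * q%:R * a ^+ m.-1)) / q%:R ^+ 2
    \in localized l.
Proof.
move=> pl ml q0 ai.
have q0' : q%:R != 0 :> rat by rewrite pnatr_eq0 -lt0n.
rewrite /hbern; case: m ml => [|m] ml.
  rewrite big_ord_recl big_ord0 /= bin0 bern0 ?expr0.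
  by rewrite [X in X / _](_ : _ = 0) ?mul0r ?rpred0 //; ring.
rewrite !big_ord_recl /= bin0 bern0 /bump /= !add1n bin1 bern1 ?expr0 ?expr1
  !subn0 subSS subn0.
rewrite [X in X / _](_ : _ = \sum_(u < m) 'C(m.+1, u.+2)%:R * bern u.+2
  * q%:R ^+ u.+2 * a ^+ (m.+1 - u.+2)); last first.
  set S := (X in _ + (_ + X) - _); rewrite -[RHS]/S.
  by clearbody S; ring.
rewrite mulr_suml; apply: rpred_sum => u _.
have -> : 'C(m.+1, u.+2)%:R * bern u.+2 * q%:R ^+ u.+2 * a ^+ (m.+1 - u.+2)
  / q%:R ^+ 2 =
  'C(m.+1, u.+2)%:R * bern u.+2 * q%:R ^+ u * a ^+ (m.+1 - u.+2)
    by rewrite !exprS; field.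
apply: rpredM; last by rewrite rpredX // int_localized.
apply: rpredM; last by rewrite rpredX // rpred_nat.
apply: rpredM; first exact: rpred_nat.
by apply: bern_localized_large => //; have := ltn_ord u; lia.
Qed.

(** The sum of the m-th powers of the integers less than q. *)
Definition powsum m q : rat := \sum_(0 <= a < q) a%:R ^+ m.

Lemma powsum_localized l q m : prime l -> (m.+1 < l)%N -> (0 < m)%N ->
  (powsum m q - q%:R * bern m) / q%:R ^+ 2 \in localized l.
Proof.
move=> pl ml m0; have [->|q0] := posnP q;
  first by rewrite expr0n invr0 mulr0 rpred0.
have q0' : q%:R != 0 :> rat by rewrite pnatr_eq0 -lt0n.
rewrite /powsum faulhaber big_ord_recr /= subnn binn expr1 divr1 mul1r.
rewrite [bern m * _]mulrC addrK mulr_suml; apply: rpred_sum => u _.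
have um := ltn_ord u.
have -> : (m - u).+1 = (m - u).-1.+2 by lia.
have n0 : (m - u).-1.+2%:R != 0 :> rat by rewrite pnatr_eq0.
have -> : 'C(m, u)%:R * bern u * q%:R ^+ (m - u).-1.+2 / (m - u).-1.+2%:R
  / q%:R ^+ 2 =
  'C(m, u)%:R * bern u * q%:R ^+ (m - u).-1 * (m - u).-1.+2%:R^-1 :> rat.
  by rewrite !exprS; move: n0; move: (_%:R^-1) => x x0; field.
apply: rpredM.
  apply: rpredM; last by rewrite rpredX // rpred_nat.
  apply: rpredM; first exact: rpred_nat.
  by apply: bern_localized_large => //; lia.
by apply: localized_inv; rewrite prime_coprime // gtnNdvd //; lia.
Qed.

Lemma localized_divP l (c x : rat) : c != 0 -> x / c \in localized l ->
  exists2 z, z \in localized l & x = c * z.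
Proof. by move=> c0 h; exists (x / c) => //; field. Qed.

Lemma modn_pow n (p a q : nat) : exists2 w : rat, w \is a Num.int &
  ((p * a) %% q)%:R ^+ n = p%:R ^+ n * a%:R ^+ n
   - n%:R * q%:R * ((p * a) %/ q)%:R * p%:R ^+ n.-1 * a%:R ^+ n.-1
     + q%:R ^+ 2 * w.
Proof.
have fi : - (q%:R * ((p * a) %/ q)%:R) \is a @Num.int rat
  by rewrite rpredN rpredM // natr_int.
have [w wi hw] := taylor2_int n (natr_int _ (p * a)) fi.
exists (((p * a) %/ q)%:R ^+ 2 * w);
  first by rewrite !(rpredM, rpredX) // natr_int.
by rewrite modn_nat_sub -natrM hw natrM !exprMn; ring.
Qed.

Lemma modn_pow1 n (p a q : nat) : exists2 w : rat, w \is a Num.int &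
  ((p * a) %% q)%:R ^+ n = p%:R ^+ n * a%:R ^+ n + q%:R * w.
Proof.
have [w wi hw] := modn_pow n p a q.
exists (- (n%:R * ((p * a) %/ q)%:R * p%:R ^+ n.-1 * a%:R ^+ n.-1) + q%:R * w).
  by rewrite !(rpredD, rpredN, rpredM, rpredX) // natr_int.
by rewrite hw; ring.
Qed.

(** The sum of a^(n-1) floor(p a / q) over a < q, which enters the expansion of
    dsum in powers of q. *)
Definition floorsum n p q : rat := \sum_(0 <= a < q) ((p * a) %/ q)%:R
  * a%:R ^+ n.-1.

Lemma localized_half l : prime l -> (2 < l)%N -> 2^-1 \in localized l.
Proof.
by move=> pl l2; apply: (@localized_inv l 2); rewrite prime_coprime // gtnNdvd.
Qed.

Lemma dsum_second_order l q i j p : prime l -> ((i + j).+1 < l)%N ->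
  (0 < q)%N ->
  (0 < i)%N -> (0 < j)%N ->
  (dsum i j p q - (p%:R ^+ j * powsum (i + j) q
     - j%:R * q%:R * p%:R ^+ j.-1 * floorsum (i + j) p q)) / q%:R ^+ 2
       \in localized l.
Proof.
move=> pl ijl q0 i0 j0.
have ij1 : (i + j).-1 = (i.-1 + j.-1).+1 by lia.
have ij2 : (i + j = (i.-1 + j.-1).+2)%N by lia.
have q0' : q%:R != 0 :> rat by rewrite pnatr_eq0 -lt0n.
have q20 : q%:R ^+ 2 != 0 :> rat by rewrite expf_neq0.
have n1 n := rpred_nat (localized l) n.
have hl : 2^-1 \in localized l by apply: localized_half => //; lia.
have /(localized_divP q20)[z zl hz] :=
  @powsum_localized l q (i + j).-1 pl ltac:(lia) ltac:(lia).
have bl : bern (i + j).-1 \in localized l by apply: bern_localized_large => //;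
  lia.
pose c : rat := i%:R * p%:R ^+ j + j%:R * p%:R ^+ j.-1.
rewrite (_ : _ / _ = (dsum i j p q - (p%:R ^+ j * powsum (i + j) q
     - j%:R * q%:R * p%:R ^+ j.-1 * floorsum (i + j) p q
     - 2^-1 * c * q%:R * powsum (i + j).-1 q)) / q%:R ^+ 2
       - 2^-1 * c * (bern (i + j).-1 + q%:R * z)); last first.
  have -> : powsum (i + j).-1 q = q%:R * bern (i + j).-1 + q%:R ^+ 2 * z
    by rewrite -hz; ring.
  by field.
apply: rpredB; last by rewrite /c !(rpredM, rpredD, rpredX) ?n1.
rewrite /dsum /powsum /floorsum !mulr_sumr -!sumrB mulr_suml.
apply: rpred_sum => a _.
have /(localized_divP q20)[e1 e1l he1] :=
  @hbern_second_order l q i a%:R pl ltac:(lia) q0 (natr_int _ a).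
have /(localized_divP q20)[e2 e2l he2] :=
  @hbern_second_order l q j ((p * a) %% q)%:R pl ltac:(lia) q0 (natr_int _ _).
have [w /(int_localized l) wl hw] := modn_pow j p a q.
have [w1 /(int_localized l) w1l hw1] := modn_pow1 j p a q.
have [w2 /(int_localized l) w2l hw2] := modn_pow1 j.-1 p a q.
set bi := hbern i _ _ in he1 *; set bj := hbern j _ _ in he2 *.
set b : rat := ((p * a) %% q)%:R in hw hw1 hw2 he2 *.
set f : rat := ((p * a) %/ q)%:R in hw *.
(* The difference to be estimated, divided by q^2, from the second order
   expansions of the two factors. *)
pose E := e1 * bj + (a%:R ^+ i - 2^-1 * i%:R * q%:R * a%:R ^+ i.-1) * e2 +
  (a%:R ^+ i * w - 2^-1 * i%:R * a%:R ^+ i.-1 * w1 - 2^-1 * j%:R * a%:R ^+ i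
    * w2
   + 2^-1 * 2^-1 * i%:R * j%:R * a%:R ^+ i.-1 * b ^+ j.-1).
have bjE : bj = b ^+ j - 2^-1 * j%:R * q%:R * b ^+ j.-1 + q%:R ^+ 2 * e2
  by rewrite -he2; ring.
have biE : bi = a%:R ^+ i - 2^-1 * i%:R * q%:R * a%:R ^+ i.-1 + q%:R ^+ 2 * e1
  by rewrite -he1; ring.
have bl' : b \in localized l := n1 _.
have bjl : bj \in localized l by rewrite bjE !(rpredB, rpredM, rpredD, rpredX)
  ?n1.
rewrite [X in X \in _](_ : _ = E).
  have [il jl al] := And3 (n1 i) (n1 j) (n1 a).
  rewrite {}/E; clearbody b f bj; move: hl il jl al (n1 q).
  move: (2^-1 : rat) (i%:R : rat) (j%:R : rat) (a%:R : rat) (q%:R : rat).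
  by move=> *; rewrite !(rpredB, rpredM, rpredD, rpredX).
apply: (mulIf q20); rewrite mulfVK //.
rewrite ij1 ij2.
have hw' : q%:R ^+ 2 * w = b ^+ j - p%:R ^+ j * a%:R ^+ j + j%:R * q%:R * f
  * p%:R ^+ j.-1 * a%:R ^+ j.-1 by rewrite hw; ring.
have hw1' : q%:R * w1 = b ^+ j - p%:R ^+ j * a%:R ^+ j by rewrite hw1; ring.
have hw2' : q%:R * w2 = b ^+ j.-1 - p%:R ^+ j.-1 * a%:R ^+ j.-1 by rewrite hw2;
  ring.
have -> : E * q%:R ^+ 2 = e1 * bj * q%:R ^+ 2
  + (a%:R ^+ i - 2^-1 * i%:R * q%:R * a%:R ^+ i.-1) * e2 * q%:R ^+ 2 +
  (a%:R ^+ i * (q%:R ^+ 2 * w) - 2^-1 * i%:R * a%:R ^+ i.-1 * q%:R * (q%:R * w1)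
    - 2^-1 * j%:R * a%:R ^+ i * q%:R * (q%:R * w2)
   + 2^-1 * 2^-1 * i%:R * j%:R * a%:R ^+ i.-1 * b ^+ j.-1 * q%:R ^+ 2).
  by rewrite /E; ring.
rewrite hw' hw1' hw2' biE bjE /c.
have -> : p%:R ^+ j = p%:R * p%:R ^+ j.-1 :> rat by rewrite -exprS prednK.
have -> : a%:R ^+ i = a%:R * a%:R ^+ i.-1 :> rat by rewrite -exprS prednK.
have -> : a%:R ^+ j = a%:R * a%:R ^+ j.-1 :> rat by rewrite -exprS prednK.
have -> : b ^+ j = b * b ^+ j.-1 :> rat by rewrite -exprS prednK.
rewrite !exprS exprD.
by field.
Qed.

(** At a large prime l, and modulo q^2, dsum is S (i p^j + j p^(-i)) / N with N
    = i + j and S the sum of the N-th powers of the integers less than q; here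
    the denominators N and p^i are cleared. *)
Lemma dsum_large l q i j p : prime l -> ((i + j).+1 < l)%N -> (0 < q)%N ->
  (0 < i)%N -> (0 < j)%N -> coprime p q ->
  ((i + j)%:R * p%:R ^+ i * dsum i j p q
    - powsum (i + j) q * (i%:R * p%:R ^+ (i + j) + j%:R)) / q%:R ^+ 2
      \in localized l.
Proof.
move=> pl ijl q0 i0 j0 cp.
have q0' : q%:R != 0 :> rat by rewrite pnatr_eq0 -lt0n.
have q20 : q%:R ^+ 2 != 0 :> rat by rewrite expf_neq0.
have n1 n := rpred_nat (localized l) n.
have /(localized_divP q20)[z1 z1l h1] := dsum_second_order p pl ijl q0 i0 j0.
(* The sum of the N-th powers of the residues p a modulo q is that of the a;
   this relates floorsum to powsum. *)
have /(localized_divP q20)[z2 z2l h2] :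
  (powsum (i + j) q - (p%:R ^+ (i + j) * powsum (i + j) q
   - (i + j)%:R * q%:R * p%:R ^+ (i + j).-1 * floorsum (i + j) p q)) / q%:R ^+ 2
     \in localized l.
  rewrite {1}/powsum -(sum_mul_mod (fun a => a%:R ^+ (i + j) : rat) cp).
  rewrite /powsum /floorsum !mulr_sumr -!sumrB mulr_suml.
  apply: rpred_sum => a _.
  have [w /(int_localized l) wl ->] := modn_pow (i + j) p a q.
  by rewrite [X in X \in _](_ : _ = w) //; field.
have -> : dsum i j p q = p%:R ^+ j * powsum (i + j) q
  - j%:R * q%:R * p%:R ^+ j.-1 * floorsum (i + j) p q + q%:R ^+ 2 * z1.
  by rewrite -h1; ring.
rewrite [X in X \in _](_ : _ = (i + j)%:R * p%:R ^+ i * z1 - j%:R * z2).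
  by rewrite !(rpredB, rpredM, rpredD, rpredX) ?n1.
apply: (mulIf q20); rewrite mulfVK //.
have -> : ((i + j)%:R * p%:R ^+ i * z1 - j%:R * z2) * q%:R ^+ 2 =
  (i + j)%:R * p%:R ^+ i * z1 * q%:R ^+ 2
   - j%:R * (q%:R ^+ 2 * z2) by ring.
rewrite -h2.
have -> : (i + j).-1 = (i + j.-1)%N by rewrite -[in LHS](prednK j0) addnS.
have -> : p%:R ^+ (i + j) = p%:R ^+ i * (p%:R * p%:R ^+ j.-1) :> rat
  by rewrite -exprS prednK // exprD.
have -> : p%:R ^+ j = p%:R * p%:R ^+ j.-1 :> rat by rewrite -exprS prednK.
by rewrite exprD natrD; ring.
Qed.

(** The three local statements put together, for q = l r. *)
Lemma dsum_difference l r i j p p1 c : prime l -> ((i + j).+1 < l)%N ->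
  (0 < r)%N ->
  (0 < i)%N -> (0 < j)%N -> ~~ (l %| r)%N -> p = p1 %[mod r] ->
  coprime p (l * r) -> coprime p1 (l * r) -> (2 * 'C(i + j, i) %| c)%N ->
  exists z : int,
    c%:R * (dsum i j p (l * r) - dsum i j p1 (l * r)) / (l * r)%:R ^+ 2 =
      z%:~R / l%:R /\
    (l%:Z %| denq (bern (i + j)) * (i + j)%:Z * p%:Z ^+ i * p1%:Z ^+ i
             * r%:Z * z
       - c%:Z * numq (bern (i + j))
         * (p1%:Z ^+ i * (i%:Z * p%:Z ^+ (i + j) + j%:Z)
            - p%:Z ^+ i * (i%:Z * p1%:Z ^+ (i + j) + j%:Z)))%Z.
Proof.
move=> pl ijl r0 i0 j0 lr pp1 cp cp1 /dvdnP[c' cE].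
have l0 : (0 < l)%N := prime_gt0 pl.
have ij0 : (0 < i + j)%N by rewrite addn_gt0 i0.
have ijl' : (i + j < l)%N := ltnW ijl.
have q0 : (0 < l * r)%N by rewrite muln_gt0 l0.
have l0' : l%:R != 0 :> rat by rewrite pnatr_eq0 -lt0n.
have r0' : r%:R != 0 :> rat by rewrite pnatr_eq0 -lt0n.
set q := (l * r)%N in cp cp1 q0 *.
have q0' : q%:R != 0 :> rat by rewrite pnatr_eq0 -lt0n.
have q20 : q%:R ^+ 2 != 0 :> rat by rewrite expf_neq0.
have qE : q%:R = l%:R * r%:R :> rat by rewrite -natrM.
have n1 n := rpred_nat (localized l) n.
have /(localized_divP q20)[e el he] := dsum_large pl ijl q0 i0 j0 cp.
have /(localized_divP q20)[e1 e1l he1] := dsum_large pl ijl q0 i0 j0 cp1.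
have /(localized_divP q20)[s sl hs] := @powsum_localized l q (i + j) pl ijl ij0.
have Bl : bern (i + j) \in localized l by apply: bern_localized_large.
set B := bern (i + j) in hs Bl *.
have SE : powsum (i + j) q = q%:R * B + q%:R ^+ 2 * s by rewrite -hs; ring.
have coprime_l x : coprime x q -> coprime l x.
  by rewrite coprime_sym; apply: coprime_dvdl; rewrite dvdn_mulr.
have dsum_div x f : coprime x q -> f \in localized l ->
   (i + j)%:R * x%:R ^+ i * dsum i j x q - powsum (i + j) q
     * (i%:R * x%:R ^+ (i + j) + j%:R) = q%:R ^+ 2 * f ->
   dsum i j x q / q%:R \in localized l.
  move=> cx fl hf; have clx := coprime_l _ cx.
  have x0 : x%:R != 0 :> rat.
    by rewrite pnatr_eq0; apply: contraTneq clx => ->;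
      rewrite /coprime gcdn0 gtn_eqF // prime_gt1.
  have N0 : (i + j)%:R != 0 :> rat by rewrite pnatr_eq0 -lt0n.
  have xi0 : x%:R ^+ i != 0 :> rat by rewrite expf_neq0.
  rewrite (_ : _ / _ = ((B + q%:R * s) * (i%:R * x%:R ^+ (i + j) + j%:R)
    + q%:R * f) * (x ^ i)%:R^-1 * (i + j)%:R^-1).
    apply: rpredM; last by apply: localized_inv;
      rewrite prime_coprime // gtnNdvd.
    apply: rpredM; last by apply: localized_inv; rewrite coprimeXr.
    by rewrite !(rpredD, rpredM, rpredX) ?n1.
  apply: (mulIf q0'); rewrite mulfVK // natrX.
  apply: (mulfI xi0); apply: (mulfI N0).
  transitivity ((i + j)%:R * x%:R ^+ i * dsum i j x q); first by ring.
  move/eqP: hf; rewrite subr_eq SE => /eqP ->.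
  by move: N0 xi0; move: (i + j)%:R (x%:R ^+ i) => u v u0 v0; field;
    rewrite u0 v0.
set X := dsum i j p q - dsum i j p1 q.
have Xq : X / q%:R \in localized l.
  by rewrite /X mulrBl rpredB // (dsum_div _ _ cp el he,
    dsum_div _ _ cp1 e1l he1).
(* Integrality of z, one prime at a time. *)
have yi : c%:R * X / (r%:R ^+ 2 * l%:R) \is a Num.int.
  apply: localized_int => v pv.
  have [vr|vr] := boolP (v %| r)%N.
    have := dsum_var_dividing i pv vr q0 j0 pp1 cp cp1; rewrite -/q -/X => h.
    rewrite (_ : _ / _ = c'%:R * (2 * 'C(i + j, i)%:R * X / r%:R ^+ 2)
      * l%:R^-1).
      apply: rpredM; first by rewrite rpredM // rpred_nat.
      apply: localized_inv; rewrite prime_coprime //; apply: contra lr.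
      by rewrite dvdn_prime2 // => /eqP <-.
    by rewrite cE !natrM; field; rewrite l0' r0'.
  have [/eqP ->|vl] := boolP (v == l).
    rewrite (_ : _ / _ = c%:R * (X / q%:R) * r%:R^-1).
      apply: rpredM; last by apply: localized_inv; rewrite prime_coprime.
      by rewrite rpredM.
    by rewrite qE; field; rewrite l0' r0'.
  have vq : ~~ (v %| q)%N.
    by rewrite /q Euclid_dvdM // negb_or vr andbT dvdn_prime2.
  have Xl : X \in localized v by exact: dsum_var_coprime.
  rewrite -natrX -natrM; apply: rpredM; first by rewrite rpredM // rpred_nat.
  by apply: localized_inv; rewrite coprimeMr coprimeXr ?prime_coprime
    // dvdn_prime2.
have /intrP[z hz] := yi; exists z; split.
  by rewrite -hz qE; field; rewrite l0' r0'.
apply: localized_dvd => //.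
rewrite !(rmorphB, rmorphM, rmorphXn, rmorphD) /=.
rewrite -!pmulrn.
have DB : (denq B)%:~R * B = (numq B)%:~R :> rat by rewrite numqE mulrC.
pose G : rat := p1%:R ^+ i * (i%:R * p%:R ^+ (i + j) + j%:R)
  - p%:R ^+ i * (i%:R * p1%:R ^+ (i + j) + j%:R).
pose E : rat := p1%:R ^+ i * e - p%:R ^+ i * e1.
have XE : (i + j)%:R * p%:R ^+ i * p1%:R ^+ i * X = powsum (i + j) q * G
  + q%:R ^+ 2 * E.
  transitivity (p1%:R ^+ i * ((i + j)%:R * p%:R ^+ i * dsum i j p q)
    - p%:R ^+ i * ((i + j)%:R * p1%:R ^+ i * dsum i j p1 q)).
    by rewrite /X; ring.
  move/eqP: he; rewrite subr_eq => /eqP ->; move/eqP: he1;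
    rewrite subr_eq => /eqP ->.
  by rewrite /G /E; ring.
rewrite (_ : _ / _ = (denq B)%:~R * c%:R * r%:R * (s * G + E)).
  have dl : (denq B)%:~R \in localized l by apply: int_localized;
    exact: intr_int.
  by rewrite /G /E !(rpredB, rpredD, rpredM, rpredX) ?n1.
apply: (mulIf l0'); rewrite mulfVK //.
rewrite -hz.
transitivity ((denq B)%:~R * c%:R * ((i + j)%:R * p%:R ^+ i * p1%:R ^+ i * X)
  / q%:R - c%:R * (numq B)%:~R * G).
  by rewrite /G natrD qE; field; rewrite l0' r0'.
rewrite XE SE -DB.
by rewrite qE; field; rewrite l0' r0'.
Qed.

(** * Scaled Dedekind sums *)

Lemma floor_divn (R : archiRealFieldType) n q : (0 < q)%N ->
  Num.floor (n%:R / q%:R : R) = (n %/ q)%N%:Z.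
Proof.
move=> q0; have q0' : 0 < q%:R :> R by rewrite ltr0n.
have e : ((n %/ q)%:Z + 1)%:~R = (n %/ q).+1%:R :> R by rewrite intrD -natr1.
apply: floor_def; rewrite e ler_pdivlMr // ltr_pdivrMr //.
by rewrite -pmulrn -!natrM ler_nat ltr_nat leq_trunc_div ltn_ceil.
Qed.

Lemma fractional_part_divn (R : archiRealFieldType) n q : (0 < q)%N ->
  fractional_part (n%:R / q%:R : R) = (n %% q)%:R / q%:R.
Proof.
move=> q0; rewrite /fractional_part floor_divn // -pmulrn.
have q0' : q%:R != 0 :> R by rewrite pnatr_eq0 -lt0n.
by rewrite {1}(divn_eq n q) natrD natrM; field.
Qed.

Lemma divn_int (R : archiRealFieldType) n q : (0 < q)%N ->
  (n%:R / q%:R : R) \is a Num.int -> (q %| n)%N.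
Proof.
move=> q0; have q0' : q%:R != 0 :> R by rewrite pnatr_eq0 -lt0n.
rewrite intrEfloor floor_divn // -pmulrn => /eqP /(congr1 (fun x => x * q%:R)).
rewrite divfK // -natrM => /eqP; rewrite eqr_nat => /eqP <-.
by rewrite dvdn_mull.
Qed.

Lemma periodic_bernoulli_hbern (R : archiRealFieldType) m n q : (0 < q)%N ->
  ~~ (q %| n)%N ->
  periodic_bernoulli m (n%:R / q%:R : R) =
    ratr (hbern m q%:R (n %% q)%:R / q%:R ^+ m).
Proof.
move=> q0 qn; have q0' : q%:R != 0 :> rat by rewrite pnatr_eq0 -lt0n.
rewrite /periodic_bernoulli ifF; last first.
  by apply: contraNF qn => /andP[_]; exact: divn_int.
rewrite fractional_part_divn // hbern_scale //.
have -> : (n %% q)%:R / q%:R = ratr ((n %% q)%:R / q%:R) :> R.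
  by rewrite fmorph_div /= !ratr_nat.
rewrite horner_map /=; congr ratr.
by field; rewrite expf_neq0.
Qed.

(** The term a = 0 of the Dedekind sum does not depend on p, so that the
    convention on the value of the first Bernoulli function at the integers
    does not matter for differences. *)
Lemma dedekind_sum_diff (R : archiRealFieldType) i j p p1 q : (0 < q)%N ->
  coprime p q -> coprime p1 q ->
  dedekind_sum i j p q - dedekind_sum i j p1 q =
  ratr ((dsum i j p q - dsum i j p1 q) / q%:R ^+ (i + j)) :> R.
Proof.
move=> q0 cp cp1; have q0' : q%:R != 0 :> rat by rewrite pnatr_eq0 -lt0n.
rewrite /dedekind_sum /dsum -!sumrB mulr_suml rmorph_sum !big_nat /=.
apply: eq_bigr => a aq.
have [->|a0] := posnP a; first by rewrite !muln0 mod0n !subrr mul0r rmorph0.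
have qa : ~~ (q %| a)%N by rewrite gtnNdvd.
have dv x : coprime x q -> ~~ (q %| x * a)%N.
  by move=> cx; rewrite Gauss_dvdr // coprime_sym.
rewrite !periodic_bernoulli_hbern ?dv // modn_small // -!rmorphM -rmorphB;
  congr ratr.
by rewrite exprD; field; rewrite !expf_neq0.
Qed.

Lemma dedekind_scale_dvd i j : (0 < i)%N -> (0 < j)%N -> ~~ odd (i + j) ->
  (2 * 'C(i + j, i) %| dedekind_scale i j)%N.
Proof.
move=> i0 j0 No; rewrite /dedekind_scale mulnC dvdn_mulr // dvdn_pmul2l.
  by apply: bernoulli_den_even => //; lia.
by rewrite bin_gt0 leq_addr.
Qed.

Lemma lcm_den_gt0 N : (0 < lcm_den N)%N.
Proof.
rewrite /lcm_den; elim/big_rec: _ => // l x _ x0.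
by rewrite lcmn_gt0 x0 andbT /rat_den absz_gt0 denq_neq0.
Qed.

Lemma dedekind_scale_gt0 i j : (0 < dedekind_scale i j)%N.
Proof.
rewrite /dedekind_scale !muln_gt0 lcm_den_gt0 bin_gt0 leq_addr !andbT.
by rewrite /bernoulli_den /rat_den absz_gt0 denq_neq0.
Qed.

(** The scaled Dedekind sum varies by z / l when p varies in a class modulo r.
    The last line is the congruence N r z = R B_N (g(p) - g(p1)) modulo l with
    g(x) = i x^j + j x^(-i), multiplied by the denominator of B_N and by p^i
    p1^i. *)
Lemma scaled_dedekind_sum_difference (R : archiRealFieldType) l r i j p p1 :
  prime l -> ((i + j).+1 < l)%N -> (0 < r)%N ->
  (0 < i)%N -> (0 < j)%N -> ~~ odd (i + j) -> ~~ (l %| r)%N ->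
    p = p1 %[mod r] ->
  coprime p (l * r) -> coprime p1 (l * r) ->
  exists z : int,
    (dedekind_scale i j)%:R * (l * r)%:R ^+ (i + j - 2)
      * dedekind_sum i j p (l * r)
    - (dedekind_scale i j)%:R * (l * r)%:R ^+ (i + j - 2)
      * dedekind_sum i j p1 (l * r)
    = z%:~R / l%:R :> R /\
    (l%:Z %| denq (bern (i + j)) * (i + j)%:Z * p%:Z ^+ i * p1%:Z ^+ i
             * r%:Z * z
       - (dedekind_scale i j)%:Z * numq (bern (i + j))
         * (p1%:Z ^+ i * (i%:Z * p%:Z ^+ (i + j) + j%:Z)
            - p%:Z ^+ i * (i%:Z * p1%:Z ^+ (i + j) + j%:Z)))%Z.
Proof.
move=> pl ijl r0 i0 j0 No lr pp1 cp cp1.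
have [z [hz hc]] := dsum_difference pl ijl r0 i0 j0 lr pp1 cp cp1
  (dedekind_scale_dvd i0 j0 No).
have q0 : (0 < l * r)%N by rewrite muln_gt0 prime_gt0.
have q0' : (l * r)%:R != 0 :> rat by rewrite pnatr_eq0 -lt0n.
exists z; split => //.
rewrite -mulrBr dedekind_sum_diff //.
have -> : z%:~R / l%:R = ratr (z%:~R / l%:R) :> R
  by rewrite fmorph_div /= ratr_int ratr_nat.
rewrite -hz -(ratr_nat R (dedekind_scale i j)) -(ratr_nat R (l * r)%N) -rmorphXn
  -!rmorphM /=; congr ratr.
have ij2 : (2 <= i + j)%N by rewrite -addn1 leq_add.
move: q0'; move: (l * r)%N%:R (dsum _ _ _ _ - _) => q x q0'.
have -> : q ^+ (i + j) = q ^+ (i + j - 2) * q ^+ 2 by rewrite -exprD subnK.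
by field; rewrite ?expf_neq0 ?q0'.
Qed.

(** * The additive character of F_l *)

(** The exponential exp(2 pi i x). *)
Definition expi {R : realType} (x : R) : R[i] :=
  Complex (cos (pi *+ 2 * x)) (sin (pi *+ 2 * x)).

Lemma expi0 (R : realType) : expi (0 : R) = 1.
Proof. by rewrite /expi mulr0 cos0 sin0. Qed.

Lemma expiD (R : realType) (x y : R) : expi (x + y) = expi x * expi y.
Proof. by rewrite /expi mulrDr cosD sinD; apply/eqP; rewrite eq_complex /=;
  apply/andP; split; apply/eqP; ring. Qed.

Lemma expiN (R : realType) (x : R) : expi (- x) = (expi x)^*%C.
Proof. by rewrite /expi mulrN cosN sinN. Qed.

Lemma norm_expi (R : realType) (x : R) : `|expi x| = 1.
Proof. by rewrite normc_def /= cos2Dsin2 sqrtr1. Qed.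

Lemma expi_nat (R : realType) n : expi (n%:R : R) = 1.
Proof.
elim: n => [|n IH]; first exact: expi0.
by rewrite -natr1 expiD IH mul1r /expi mulr1 cos2pi sin2pi.
Qed.

Lemma expi_int (R : realType) (m : int) : expi (m%:~R : R) = 1.
Proof.
case: m => n; first exact: expi_nat.
by rewrite NegzE rmorphN /= expiN expi_nat conjc1.
Qed.

Lemma expi_fractional_part (R : realType) (m : int) (x y : R) :
  expi (m%:~R * fractional_part x + y) = expi (m%:~R * x + y).
Proof.
have -> : m%:~R * x + y = m%:~R * fractional_part x + y + (m * Num.floor x)%:~R.
  by rewrite /fractional_part intrM; ring.
by rewrite [RHS]expiD expi_int mulr1.
Qed.

(** The additive character x |-> exp(2 pi i x / l) of F_l, evaluated at the
    representative of x in [0, l[. *)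
Definition chi (R : realType) (l : nat) (x : 'F_l) : R[i] :=
  expi ((x : nat)%:R / l%:R).

Lemma chi_nat (R : realType) l n : prime l ->
  chi R (n%:R : 'F_l) = expi (n%:R / l%:R).
Proof.
move=> pl; have l0 : l%:R != 0 :> R by rewrite pnatr_eq0 -lt0n prime_gt0.
rewrite /chi val_Fp_nat // {2}(divn_eq n l) natrD natrM mulrDl mulfK //.
by rewrite expiD expi_nat mul1r.
Qed.

Lemma chiD (R : realType) l (x y : 'F_l) : prime l ->
  chi R (x + y) = chi R x * chi R y.
Proof.
by move=> pl; rewrite -[x]natr_Zp -[y]natr_Zp -natrD !chi_nat // natrD mulrDl
  expiD.
Qed.

Lemma chi0 (R : realType) l : chi R (0 : 'F_l) = 1.
Proof. by rewrite /chi mul0r expi0. Qed.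

Lemma norm_chi (R : realType) l (x : 'F_l) : `|chi R x| = 1.
Proof. exact: norm_expi. Qed.

Lemma chiN (R : realType) l (x : 'F_l) : prime l -> chi R (- x) = (chi R x)^*%C.
Proof.
move=> pl; have c0 : chi R x != 0 by rewrite -normr_eq0 norm_chi oner_eq0.
apply: (mulfI c0); rewrite -chiD // subrr chi0 -sqr_normc norm_chi expr1n //.
Qed.

Lemma chi_int (R : realType) l (z : int) : prime l ->
  chi R (z%:~R : 'F_l) = expi (z%:~R / l%:R).
Proof.
move=> pl; case: z => n; first exact: chi_nat.
by rewrite NegzE !rmorphN /= chiN // -pmulrn chi_nat // -pmulrn mulNr expiN.
Qed.

Lemma chi1_neq1 (R : realType) l : prime l -> chi R (1 : 'F_l) != 1.
Proof.
move=> pl; have -> : (1 : 'F_l) = 1%:R by [].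
rewrite chi_nat // div1r; apply/negP => /eqP; rewrite /expi => -[h _].
have l0 : 0 < l%:R :> R by rewrite ltr0n prime_gt0.
have l2 : 2 <= l%:R :> R by rewrite ler_nat prime_gt1.
have p0 := @pi_gt0 R.
have : pi *+ 2 * l%:R^-1 = 0 :> R.
  have hx : pi *+ 2 * l%:R^-1 \in `[0, pi : R].
    rewrite in_itv /=; apply/andP; split.
      by rewrite mulr_ge0 ?invr_ge0 ?ler0n // mulrn_wge0 // ltW.
    by rewrite ler_pdivrMr // -[pi *+ 2](mulr_natr pi 2) ler_wpM2l // ltW.
  have h0 : 0 \in `[0, pi : R] by rewrite in_itv /=; apply/andP; split;
    rewrite // ltW.
  by apply: (cos_inj hx h0); rewrite h cos0.
by move/eqP; rewrite mulf_eq0 invr_eq0 (gt_eqF l0) orbF gt_eqF // mulrn_wgt0.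
Qed.

Lemma sum_chi (R : realType) l (t : 'F_l) : prime l ->
  \sum_(u : 'F_l) chi R (u * t) = if t == 0 then l%:R else 0.
Proof.
move=> pl; have [->|t0] := eqVneq.
  under eq_bigr do rewrite mulr0 chi0.
  by rewrite sumr_const card_Fp.
set S := \sum_(u : _) _.
have : chi R (1 : 'F_l) * S = S.
  rewrite /S mulr_sumr [RHS](reindex_inj (addrI t^-1)) /=.
  by apply: eq_bigr => u _; rewrite mulrDl mulVf // chiD.
move/eqP; rewrite -subr_eq0 -{2}[S]mul1r -mulrBl mulf_eq0 subr_eq0.
by rewrite (negPf (chi1_neq1 R pl)) => /eqP.
Qed.

(** The exponential sum T(u) of the function h over the nonzero elements of
    F_l. *)
Definition expsum (R : realType) l (h : 'F_l -> 'F_l) (u : 'F_l) : R[i] :=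
  \sum_(x : 'F_l | x != 0) chi R (u * h x).

(** By orthogonality, the sum of |T(u)|^2 over u is l times the number of pairs
    (x, y) of nonzero elements with h(x) = h(y), and there are at most (l - 1)
    D such pairs. *)
Lemma expsum_second_moment (R : realType) l (h : 'F_l -> 'F_l) D : prime l ->
  (forall c, (#|[pred x : 'F_l | (x != 0%R) && (h x == c)]| <= D)%N) ->
  \sum_(u : 'F_l) `|expsum R h u| ^+ 2 <= (l * (l.-1 * D))%:R.
Proof.
move=> pl hD.
have -> : \sum_(u : 'F_l) `|expsum R h u| ^+ 2 =
   \sum_(y : 'F_l | y != 0) \sum_(x : 'F_l | x != 0) \sum_(u : 'F_l) chi R
     (u * (h x - h y)).
  under [RHS]eq_bigr do rewrite exchange_big.
  rewrite exchange_big /=; apply: eq_bigr => u _.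
  rewrite sqr_normc /expsum mulrC rmorph_sum /= mulr_suml;
    apply: eq_bigr => y _.
  rewrite mulr_sumr; apply: eq_bigr => x _.
  by rewrite mulrBr chiD // chiN // mulrC.
apply: (@le_trans _ _ (\sum_(y : 'F_l | y != 0) (l * D)%:R)).
  apply: ler_sum => y _.
  under eq_bigr do rewrite sum_chi // subr_eq0.
  rewrite -big_mkcondr sumr_const -mulrnA ler_nat leq_mul2l.
  by rewrite (leq_trans _ (hD (h y))) ?orbT // subset_leq_card //;
    apply/subsetP => x.
have hc : #|[pred y : 'F_l | y != 0]| = l.-1.
  by rewrite -[in RHS](card_Fp pl) -(cardC1 (0 : 'F_l)); apply: eq_card.
by rewrite sumr_const hc -mulrnA ler_nat -mulnA [(D * _)%N]mulnC.
Qed.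

(** Chebyshev's inequality: the number of frequencies u for which |T(u)| is not
    at most e (l - 1) is bounded independently of l. *)
Lemma card_bad_expsum (R : realType) l (h : 'F_l -> 'F_l) D (e : R) : prime l ->
  0 < e ->
  (forall c, (#|[pred x : 'F_l | (x != 0%R) && (h x == c)]| <= D)%N) ->
  (#|[pred u : 'F_l | ~~ (`|expsum R h u| <= (e * l.-1%:R)%:C%C)]|)%:R <=
    2 * D%:R / e ^+ 2.
Proof.
move=> pl e0 hD; set A := [pred u | _].
have l1 : (0 < l.-1)%N by have := prime_gt1 pl; lia.
have l0 : 0 < l.-1%:R :> R by rewrite ltr0n.
have := expsum_second_moment R pl hD.
have h1 : ((#|A|)%:R * (e * l.-1%:R) ^+ 2)%:C%C <=
  \sum_(u : 'F_l) `|expsum R h u| ^+ 2.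
  rewrite (bigID (mem A)) /=.
  apply: (@le_trans _ _ (\sum_(u in A) (((e * l.-1%:R) ^+ 2)%:C%C))).
    by rewrite sumr_const rmorphM /= rmorph_nat mulr_natl.
  rewrite -[leLHS]addr0; apply: lerD; last by apply: sumr_ge0 => u _;
    rewrite exprn_ge0.
  apply: ler_sum => u; rewrite inE => hu.
  have {}hu : (e * l.-1%:R)%:C%C < `|expsum R h u|.
    rewrite real_ltNge ?normr_real //.
    by apply/complex_realP; exists (e * l.-1%:R).
  rewrite rmorphXn ler_pXn2r // ?nnegrE ?normr_ge0 ?(ltW hu) //.
  by rewrite ler0c mulr_ge0 // ltW.
move/(le_trans h1); rewrite -(rmorph_nat (real_complex R)) lecR => h2.
rewrite ler_pdivlMr ?exprn_gt0 //.
have h3 : (#|A|)%:R * e ^+ 2 * l.-1%:R <= l%:R * D%:R :> R.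
  rewrite -(ler_pM2r l0); move: h2; rewrite !natrM => h2.
  have -> : (#|A|)%:R * e ^+ 2 * l.-1%:R * l.-1%:R =
    (#|A|)%:R * (e * l.-1%:R) ^+ 2 by ring.
  by have -> : l%:R * D%:R * l.-1%:R = l%:R * (l.-1%:R * D%:R) :> R by ring.
have l2 : l%:R <= 2 * l.-1%:R :> R by rewrite -natrM ler_nat; lia.
rewrite -(ler_pM2r l0); apply: (le_trans h3).
by rewrite mulrAC ler_wpM2r.
Qed.

(** * Weyl sums for a fixed q *)

(** The Laurent polynomial A x + B (i x^j + j x^(-i)) over F_l. *)
Definition laurent l i j (A B x : 'F_l) : 'F_l :=
  A * x + B * (i%:R * x ^+ j + j%:R * x ^- i).

Lemma card_laurent_fiber l i j (A B c : 'F_l) : (0 < i)%N -> (0 < j)%N ->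
  B * j%:R != 0 \/ B = 0 /\ A != 0 ->
  (#|[pred x : 'F_l | (x != 0%R) && (laurent i j A B x == c)]| <= i + j)%N.
Proof.
move=> i0 j0 hAB.
pose P : {poly 'F_l} := A *: 'X^(i.+1) + (B * i%:R) *: 'X^(i + j)
  + (B * j%:R)%:P - c *: 'X^i.
have Pn0 : P != 0.
  apply/eqP => P0; case: hAB => [Bj|[B0 An0]].
    have : P`_0 = 0 by rewrite P0 coef0.
    rewrite /P !(coefB, coefD, coefZ, coefXn, coefC) /=.
    have -> : (0 == i)%N = false by lia.
    have -> : (0 == i + j)%N = false by lia.
    by rewrite !mulr0 !add0r subr0; apply/eqP.
  have : P`_i.+1 = 0 by rewrite P0 coef0.
  rewrite /P B0 !(coefB, coefD, coefZ, coefXn, coefC) /= !mul0r eqxx mulr1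
    !addr0.
  have -> : (i.+1 == i)%N = false by lia.
  by rewrite mulr0 subr0; apply/eqP.
have sP : (size P <= (i + j).+1)%N.
  apply/leq_sizeP => k hk.
  rewrite !(coefB, coefD, coefZ, coefXn, coefC).
  have -> : (k == i.+1)%N = false by lia.
  have -> : (k == i + j)%N = false by lia.
  have -> : (k == 0)%N = false by lia.
  have -> : (k == i)%N = false by lia.
  by rewrite !mulr0 !addr0 subr0.
rewrite cardE; set rs := enum _.
have urs : uniq rs by apply: enum_uniq.
rewrite -ltnS; apply: leq_trans sP; apply: max_poly_roots => //.
apply/allP => x; rewrite mem_enum inE => /andP[x0 /eqP hx].
rewrite /root /P !(hornerD, hornerN, hornerZ, hornerXn, hornerC).
have xi0 : x ^+ i != 0 by rewrite expf_neq0.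
apply/eqP; rewrite -hx /laurent exprS exprD.
by field.
Qed.

Lemma Fp_int_eq0 l (z : int) : prime l -> (l%:Z %| z)%Z -> (z%:~R : 'F_l) = 0.
Proof.
move=> pl /dvdzP[y ->]; rewrite intrM.
have -> : (l%:Z%:~R : 'F_l) = 0; last by rewrite mulr0.
by rewrite -pmulrn; apply: val_inj; rewrite /= val_Fp_nat // modnn.
Qed.

Lemma Fp_nat_eq0 l n : prime l -> ((n%:R : 'F_l) == 0) = (l %| n)%N.
Proof.
move=> pl; apply/eqP/idP => [h|/dvdnP[k ->]]; last first.
  rewrite natrM; have -> : (l%:R : 'F_l) = 0; last by rewrite mulr0.
  by apply: val_inj; rewrite /= val_Fp_nat // modnn.
by have := congr1 val h; rewrite /= val_Fp_nat // => /eqP.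
Qed.

(** The phase m1 x + m2 y of the point (x, y) attached to (p, q), without
    reduction modulo 1. *)
Definition weyl_phase (R : realType) (m1 m2 : int) i j p q : R :=
  m1%:~R * (p%:R / q%:R) +
  m2%:~R * ((dedekind_scale i j)%:R * q%:R ^+ (i + j - 2)
    * dedekind_sum i j p q).

(** The coefficient m1 beta N of x in the Laurent polynomial h of the Weyl sum
    modulo l, where beta is the denominator of B_N; the factor beta N clears
    denominators. *)
Definition phase_coef1 (m1 : int) N l : 'F_l := (m1 * denq (bern N) * N%:Z)%:~R.

(** The coefficient m2 R alpha of i x^j + j x^(-i) in h, where alpha is the
    numerator of B_N. *)
Definition phase_coef2 (m2 : int) i j l : 'F_l :=
  (m2 * (dedekind_scale i j)%:Z * numq (bern (i + j)))%:~R.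

(** The Laurent polynomial h of the Weyl sum modulo l. *)
Definition phase_poly m1 m2 i j l : 'F_l -> 'F_l :=
  laurent i j (phase_coef1 m1 (i + j) l) (phase_coef2 m2 i j l).

(** The frequency at which h is evaluated when q = l r, namely the inverse of
    beta N r modulo l. It depends only on r modulo l. *)
Definition phase_freq N l r : 'F_l := ((denq (bern N))%:~R * N%:R * r%:R)^-1.

(** The comparison of the phases at p and p1 modulo l, as an identity of
    rational functions; pi, pj, p1i and p1j stand for the powers of p and
    p1. *)
Lemma phase_identity (F : fieldType)
  (d n m1 m2 c z i j r p p1 pi pj p1i p1j : F) :
  d * (i + j) * pi * p1i * r * z -
    c * n * (p1i * (i * (pi * pj) + j) - pi * (i * (p1i * p1j) + j)) = 0 ->
  d != 0 -> r != 0 -> i + j != 0 -> pi != 0 -> p1i != 0 ->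
  m1 * ((p - p1) / r) + m2 * z =
  (d * (i + j) * r)^-1 *
    (m1 * d * (i + j) * p + m2 * c * n * (i * pj + j * pi^-1)
     - (m1 * d * (i + j) * p1 + m2 * c * n * (i * p1j + j * p1i^-1))).
Proof.
move=> /eqP; rewrite subr_eq0 => /eqP hz d0 r0 s0 pi0 p1i0.
have D0 : d * (i + j) * pi * p1i * r != 0 by rewrite !mulf_neq0.
have -> : z = c * n * (p1i * (i * (pi * pj) + j) - pi * (i * (p1i * p1j) + j)) /
    (d * (i + j) * pi * p1i * r) by rewrite -hz; field;
      rewrite d0 s0 pi0 p1i0 r0.
by field; rewrite d0 s0 pi0 p1i0 r0.
Qed.

(** On a class of p modulo r the exponential is a constant multiple of the
    additive character of F_l. *)
Lemma expi_phase_shift (R : realType) m1 m2 l r i j p p1 :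
  prime l -> ((i + j).+1 < l)%N -> (0 < r)%N ->
  (0 < i)%N -> (0 < j)%N -> ~~ odd (i + j) -> ~~ (l %| r)%N ->
    p = p1 %[mod r] ->
  coprime p (l * r) -> coprime p1 (l * r) ->
  expi (weyl_phase R m1 m2 i j p (l * r)) =
  expi (weyl_phase R m1 m2 i j p1 (l * r)) *
  chi R (phase_freq (i + j) l r * (phase_poly m1 m2 i j p%:R
    - phase_poly m1 m2 i j p1%:R)).
Proof.
move=> pl ijl r0 i0 j0 No lr pp1 cp cp1.
have [z [hz hc]] := scaled_dedekind_sum_difference R pl ijl r0 i0 j0 No lr pp1
  cp cp1.
have [t ht] : exists t : int, p%:Z - p1%:Z = t * r%:Z.
  have : (r%:Z %| p%:Z - p1%:Z)%Z.
    by rewrite -eqz_mod_dvd; apply/eqP; rewrite !modz_nat pp1.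
  by case/dvdzP => t ht; exists t.
have l0 : l%:R != 0 :> R by rewrite pnatr_eq0 -lt0n prime_gt0.
have r0' : r%:R != 0 :> R by rewrite pnatr_eq0 -lt0n.
have pE : p%:R = p1%:R + t%:~R * r%:R :> R.
  have -> : (r%:R : R) = r%:Z%:~R by [].
  by rewrite -intrM -ht intrB /= addrC subrK.
have -> : weyl_phase R m1 m2 i j p (l * r) = weyl_phase R m1 m2 i j p1 (l * r)
  + (m1 * t + m2 * z)%:~R / l%:R.
  rewrite /weyl_phase; move/eqP: hz; rewrite subr_eq => /eqP ->.
  rewrite intrD !intrM pE natrM; set x := dedekind_sum _ _ _ _; clearbody x.
  by field; rewrite l0 r0'.
rewrite expiD -chi_int //; congr (_ * chi R _).
have nz x : coprime x (l * r) -> (x%:R : 'F_l) != 0.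
  rewrite coprimeMr => /andP[]; rewrite coprime_sym prime_coprime // => h _.
  by rewrite Fp_nat_eq0.
have p0 := nz _ cp; have p10 := nz _ cp1.
have rn0 : (r%:R : 'F_l) != 0 by rewrite Fp_nat_eq0.
have N0 : ((i + j)%:R : 'F_l) != 0.
  by rewrite Fp_nat_eq0 // gtnNdvd ?addn_gt0 ?i0 // ltnW.
have d0 : ((denq (bern (i + j)))%:~R : 'F_l) != 0.
  have := bern_localized_large pl ijl;
    rewrite unfold_in /localized prime_coprime //.
  by rewrite -(Fp_nat_eq0 _ pl) pmulrn gez0_abs ?denq_ge0.
have pi0 : (p%:R : 'F_l) ^+ i != 0 by rewrite expf_neq0.
have p1i0 : (p1%:R : 'F_l) ^+ i != 0 by rewrite expf_neq0.
rewrite /phase_poly /phase_coef2; clear hz;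
  move: (dedekind_scale i j) hc => C hc.
have := Fp_int_eq0 pl hc.
rewrite !(rmorphB, rmorphM, rmorphXn, rmorphD) /= -!pmulrn => hzl.
have tl : (t%:~R : 'F_l) = (p%:R - p1%:R) / r%:R.
  apply: (mulIf rn0); rewrite divfK //.
  by have := congr1 (fun x : int => x%:~R : 'F_l) ht;
    rewrite /= intrB intrM /= -!pmulrn => ->.
rewrite tl.
rewrite /phase_freq /phase_poly /laurent /phase_coef1 /phase_coef2 !intrM
  -!pmulrn.
move: hzl d0 p0 p10 rn0 N0 pi0 p1i0; rewrite !exprD natrD.
move: (denq _)%:~R (numq _)%:~R => d n.
move: (z%:~R) (m1%:~R) (m2%:~R) (C%:R) => zz mm1 mm2 c.
move=> hzl d0 p0 p10 rn0 N0 pi0 p1i0.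
exact: (@phase_identity 'F_l d n mm1 mm2 c zz i%:R j%:R r%:R p%:R p1%:R
  (p%:R ^+ i) (p%:R ^+ j) (p1%:R ^+ i) (p1%:R ^+ j) hzl d0 rn0 N0 pi0 p1i0).
Qed.

(** The p < l r prime to l r in a given class modulo r are indexed by F_l^*, by
    the Chinese remainder theorem. *)
Lemma sum_residue_class (V : nmodType) l r c (F : 'F_l -> V) : prime l ->
  (0 < r)%N ->
  ~~ (l %| r)%N -> coprime c r -> (c < r)%N ->
  \sum_(p < l * r | coprime p (l * r) && (p %% r == c)%N) F (nat_of_ord p)%:R =
  \sum_(x : 'F_l | x != 0) F x.
Proof.
move=> pl r0 lr cr cltr.
have clr : coprime l r by rewrite prime_coprime.
have q0 : (0 < l * r)%N by rewrite muln_gt0 prime_gt0.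
pose f (x : 'F_l) : 'I_(l * r) := Ordinal (ltn_pmod (chinese l r x c) q0).
have fl x : (f x %% l = x)%N.
  rewrite /= modn_dvdm ?dvdn_mulr // chinese_modl // modn_small //.
  by have := ltn_ord x; rewrite {2}(Fp_cast pl).
have fr x : (f x %% r = c)%N.
  by rewrite /= modn_dvdm ?dvdn_mull // chinese_modr // modn_small.
have fK x : (nat_of_ord (f x))%:R = x.
  by apply: val_inj; rewrite /= val_Fp_nat // fl.
rewrite (reindex_onto f (fun p => (nat_of_ord p)%:R : 'F_l)) /=.
  apply: eq_big => [x|x _]; last by rewrite -/(f x) fK.
  rewrite -[X in coprime X]/(nat_of_ord (f x))
    -[X in (X %% r == c)%N]/(nat_of_ord (f x)).
  rewrite -[X in (X%:R == x)]/(nat_of_ord (f x)) fr fK !eqxx !andbT.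
  rewrite coprimeMr -[X in _ && X]coprime_modl fr cr andbT coprime_sym
    prime_coprime //.
  by rewrite -(Fp_nat_eq0 _ pl) fK.
move=> p /andP[_ /eqP pc]; apply: val_inj => /=.
rewrite val_Fp_nat // -pc -(chinese_mod clr).
by rewrite modn_small.
Qed.

(** The sum over p splits along the classes modulo r prime to r, and on each of
    them its modulus is that of one and the same sum over F_l^*. *)
Lemma weyl_sum_local_bound (R : realType) m1 m2 l r i j :
  prime l -> ((i + j).+1 < l)%N -> (0 < r)%N ->
  (0 < i)%N -> (0 < j)%N -> ~~ odd (i + j) -> ~~ (l %| r)%N ->
  `|\sum_(0 <= p < l * r | coprime p (l * r)) expi
    (weyl_phase R m1 m2 i j p (l * r))|
  <= (totient r)%:R * `|expsum R (@phase_poly m1 m2 i j l)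
    (phase_freq (i + j) l r)|.
Proof.
move=> pl ijl r0 i0 j0 No lr.
have clr : coprime l r by rewrite prime_coprime.
have q0 : (0 < l * r)%N by rewrite muln_gt0 prime_gt0.
rewrite big_mkord.
rewrite (partition_big (fun p : 'I_(l * r) => Ordinal (ltn_pmod p r0)) xpredT)
  //=.
rewrite totient_count_coprime big_mkord natr_sum mulr_suml.
apply: le_trans (ler_norm_sum _ _ _) _; apply: ler_sum => c _.
have [cr|cr] := boolP (coprime r c); last first.
  rewrite mul0r big1 ?normr0 // => p /andP[cp /eqP/(congr1 val) /= pc].
  by move: cr; rewrite -pc coprime_modr coprime_sym; move: cp;
    rewrite coprimeMr => /andP[_ ->].
rewrite mul1r.
have cr' : coprime c r by rewrite coprime_sym.
pose p1 := chinese l r 1 c.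
have p1r : (p1 %% r = c)%N by rewrite /p1 chinese_modr // modn_small.
have p1l : (p1 %% l = 1)%N by rewrite /p1 chinese_modl // modn_small
  // prime_gt1.
have cp1 : coprime p1 (l * r).
  rewrite coprimeMr -(coprime_modl p1 r) p1r cr' andbT -(coprime_modl p1 l) p1l.
  exact: coprime1n.
set u := phase_freq _ _ _; set h := @phase_poly m1 m2 i j l.
pose K := expi (weyl_phase R m1 m2 i j p1 (l * r)) * chi R (- (u * h p1%:R)).
have Eq : forall p : 'I_(l * r), coprime p (l * r) &&
  (Ordinal (ltn_pmod p r0) == c) ->
    expi (weyl_phase R m1 m2 i j p (l * r)) =
      K * chi R (u * h (nat_of_ord p)%:R).
  move=> p /andP[cp /eqP/(congr1 val) /= pc].
  rewrite (@expi_phase_shift R m1 m2 l r i j p p1) //; last by rewrite pc p1r.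
  by rewrite /K -mulrA -chiD // mulrBr addrC.
rewrite (eq_bigr _ Eq) -mulr_sumr normrM.
have -> : `|K| = 1 by rewrite /K normrM norm_expi norm_chi mulr1.
rewrite mul1r /expsum.
rewrite -(@sum_residue_class R[i] l r c (fun x => chi R (u * h x)) pl r0 lr cr'
  (ltn_ord c)).
by rewrite le_eqVlt; apply/orP; left; apply/eqP.
Qed.

(** * Divergence of the sum of prime reciprocals *)

Lemma exp2_gt_poly k : exists m, (2 * m.+1 ^ k < 2 ^ m)%N.
Proof.
have sq t : (4 <= t)%N -> (t * t <= 2 ^ t)%N.
  elim: t => // t IH; rewrite leq_eqVlt => /predU1P[<- //|t4].
  have := IH t4; rewrite expnS; nia.
(* For m + 1 = 2^t the claim is t k + 2 <= 2^t. *)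
pose t := k.+4.
exists (2 ^ t).-1; rewrite prednK ?expn_gt0 // -expnM -expnS ltn_exp2l //.
by have := sq t isT; rewrite /t; nia.
Qed.

Lemma logn_le_exp2 p n m : (0 < n)%N -> (n <= 2 ^ m)%N -> (logn p n <= m)%N.
Proof.
move=> n0 nm; have [pp|npp] := boolP (prime p);
  last by rewrite /logn (negPf npp).
rewrite -(leq_exp2l _ _ (isT : 1 < 2)%N); apply: leq_trans nm.
apply: leq_trans (dvdn_leq n0 (pfactor_dvdnn p n)).
by case: (logn p n) => // e; rewrite leq_exp2r // prime_gt1.
Qed.

Lemma sum_pred_le_card_in (T : finType) (A : pred T) (s : seq nat)
  (a : pred nat) (f : nat -> T) :
  uniq s -> {in s, forall n, a n -> f n \in A} ->
  {in [pred n | (n \in s) && a n] &, injective f} ->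
  (\sum_(n <- s) a n <= #|A|)%N.
Proof.
move=> us fA fi.
have -> : (\sum_(n <- s) a n = size (map f [seq n <- s | a n]))%N.
  by rewrite size_map size_filter -sum1_count [RHS]big_mkcond;
    apply: eq_bigr => n _; case: (a n).
have u : uniq (map f [seq n <- s | a n]).
  rewrite map_inj_in_uniq ?filter_uniq // => x y;
    rewrite !mem_filter => /andP[ax xs] /andP[ay ys].
  by apply: fi; rewrite inE ?xs ?ys.
rewrite -(card_uniqP u); apply: subset_leq_card;
  apply/fintype.subsetP => y /mapP[n].
by rewrite mem_filter => /andP[an ns] ->; apply: fA.
Qed.

Lemma sum_pred_le_card (T : finType) (s : seq nat) (a : pred nat)
  (f : nat -> T) :
  uniq s -> {in [pred n | (n \in s) && a n] &, injective f} ->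
  (\sum_(n <- s) a n <= #|T|)%N.
Proof. by move=> us fi; apply: sum_pred_le_card_in us _ fi. Qed.

(** There are few integers up to 2^m all of whose prime factors are at most K,
    since such an integer is determined by K + 1 exponents that are at most
    m. *)
Lemma count_smooth K m :
  (\sum_(1 <= n < (2 ^ m).+1) all (fun p => p <= K)%N (primes n) <=
    m.+1 ^ K.+1)%N.
Proof.
have -> : (m.+1 ^ K.+1 = #|{ffun 'I_K.+1 -> 'I_m.+1}|)%N
  by rewrite card_ffun !card_ord.
apply: (@sum_pred_le_card _ _ _ (fun n
  => [ffun p : 'I_K.+1 => inord (logn p n) : 'I_m.+1])).
  exact: iota_uniq.
move=> x y; rewrite !inE !mem_index_iota
  => /andP[/andP[x0 xm] sx] /andP[/andP[y0 ym] sy] /ffunP h.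
apply: eqn_from_log => // p.
have [pK|pK] := leqP p K.
  have := h (inord p); rewrite !ffunE => /(congr1 val) /=.
  by rewrite !inordK // ltnS logn_le_exp2.
have lz z : (0 < z)%N -> all (fun p => p <= K)%N (primes z) -> logn p z = 0%N.
  move=> z0 /allP az; apply/eqP; rewrite -leqn0 leqNgt logn_gt0.
  by apply/negP => /az; rewrite leqNgt pK.
by rewrite !lz.
Qed.

(** The primes p such that K < p < L. *)
Definition primes_between K L := [seq p <- index_iota K.+1 L | prime p].

(** Erdos's argument for the divergence of the sum of the inverses of the
    primes. *)
Lemma prime_reciprocals_half (R : realType) K :
  exists L, 2^-1 <= \sum_(p <- primes_between K L) p%:R^-1 :> R.
Proof.
have [m hm] := exp2_gt_poly K.+1.
pose x := (2 ^ m)%N; exists x.+1; rewrite leNgt; apply/negP => hlt.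
(* An integer up to x has all its prime factors at most K or is divisible by a
   prime in ]K, x]. *)
have h : (x <= m.+1 ^ K.+1 + \sum_(p <- primes_between K x.+1) x %/ p)%N.
  apply: (@leq_trans (\sum_(1 <= n < x.+1) (all (fun p => p <= K)%N (primes n) +
      \sum_(p <- primes_between K x.+1) (p %| n)))%N).
    apply: (@leq_trans (\sum_(1 <= n < x.+1) 1)%N).
      by rewrite sum_nat_const_nat subn1 muln1.
    rewrite !big_nat; apply: leq_sum => n /andP[n0 nx].
    have [//|/allPn[p]] := boolP (all _ _).
    rewrite mem_primes -ltnNge => /and3P[pp _ pn] Kp.
    rewrite add0n (big_rem p) /=; first by rewrite pn.
    rewrite mem_filter pp mem_index_iota Kp /= ltnS.
    by apply: leq_trans (dvdn_leq n0 pn) _; rewrite -ltnS.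
  rewrite big_split /= leq_add ?count_smooth // exchange_big /=.
  by rewrite leq_eqVlt; apply/orP; left; apply/eqP; apply: eq_bigr => p _;
    rewrite divn_count_dvd.
have x0 : 0 < x%:R :> R by rewrite ltr0n expn_gt0.
have : x%:R <= (m.+1 ^ K.+1)%:R + x%:R
  * \sum_(p <- primes_between K x.+1) p%:R^-1 :> R.
  rewrite mulr_sumr;
    apply: (@le_trans _ _ (m.+1 ^ K.+1
      + \sum_(p <- primes_between K x.+1) x %/ p)%:R).
    by rewrite ler_nat.
  rewrite natrD lerD2l natr_sum big_seq [leRHS]big_seq; apply: ler_sum => p.
  rewrite mem_filter => /andP[pp _].
  by rewrite ler_pdivlMr ?ltr0n ?prime_gt0 // -natrM ler_nat leq_trunc_div.
apply/negP; rewrite -ltNge.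
have h2 : (m.+1 ^ K.+1)%:R < x%:R / 2 :> R.
  by rewrite ltr_pdivlMr // -natrM ltr_nat mulnC.
have h3 : x%:R * \sum_(p <- primes_between K x.+1) p%:R^-1 < x%:R / 2 :> R
  by rewrite ltr_pM2l.
by lra.
Qed.

Lemma prime_reciprocals_diverge (R : realType) K M :
  exists2 L, (K <= L)%N & M%:R / 2 <= \sum_(p <- primes_between K L) p%:R^-1
    :> R.
Proof.
elim: M => [|M [L KL hL]].
  by exists K => //; rewrite mul0r sumr_ge0 // => p _; rewrite invr_ge0.
have [L' hL'] := prime_reciprocals_half R L.
have LL' : (L < L')%N.
  rewrite ltnNge; apply/negP => h; move: hL'.
  rewrite /primes_between /index_iota (_ : L' - L.+1 = 0)%N ?big_nil;
    last by lia.
  by rewrite leNgt invr_gt0 ltr0n.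
exists L'; first by apply: ltnW (leq_ltn_trans KL LL').
rewrite -natr1 mulrDl div1r; apply: le_trans (lerD hL hL') _.
rewrite /primes_between !big_filter.
have [KL'|] := ltnP K L; last first.
  move=> LK; rewrite [X in X + _]big_geq 1?leqW // add0r.
  by have -> : K = L by apply/eqP; rewrite eqn_leq KL.
rewrite [leRHS](big_cat_nat (n := L)) //=; last exact: ltnW.
rewrite lerD2l [leRHS]big_ltn_cond //.
by case: ifP => // _; rewrite lerDr invr_ge0.
Qed.

(** * Integers with a good prime factor *)

Lemma divn_bounds (R : realType) (x p : nat) : (0 < p)%N ->
  x%:R / p%:R - 1 <= (x %/ p)%:R :> R /\ (x %/ p)%:R <= x%:R / p%:R :> R.
Proof.
move=> p0; have p0' : 0 < p%:R :> R by rewrite ltr0n.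
split; last by rewrite ler_pdivlMr // -natrM ler_nat leq_trunc_div.
rewrite lerBlDr natr1 ler_pdivrMr // -natrM ler_nat.
exact: ltnW (ltn_ceil _ _).
Qed.

(** Turan's second moment argument: if the sum W of the inverses of the primes
    in ps is large, then few q <= x are divisible by none of them. It rests on
    the mean square of the number of these prime factors of q minus W. *)
Lemma turan (R : realType) (ps : seq nat) (x : nat) :
  uniq ps -> all prime ps ->
  (\sum_(1 <= q < x.+1) all (fun p => ~~ (p %| q)) ps)%N%:R
    * \sum_(p <- ps) p%:R^-1
    <= x%:R + 2 * (size ps)%:R :> R.
Proof.
move=> ups /allP aps.
set W := \sum_(p <- ps) p%:R^-1.
have W0 : 0 <= W by apply: sumr_ge0 => p _; rewrite invr_ge0.
pose om q : R := \sum_(p <- ps) (p %| q)%:R.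
set A := (\sum_(1 <= q < x.+1) _)%N.
have h1 : A%:R * W ^+ 2 <= \sum_(1 <= q < x.+1) (om q - W) ^+ 2.
  rewrite /A natr_sum mulr_suml; apply: ler_sum => q _.
  case: allP => [hq|_]; last by rewrite mul0r sqr_ge0.
  rewrite mul1r /om big_seq big1 ?sub0r ?sqrrN // => p pp.
  by rewrite (negPf (hq _ pp)).
have h2 : x%:R * W - (size ps)%:R <= \sum_(1 <= q < x.+1) om q.
  rewrite exchange_big /= /W mulr_sumr -sum1_size natr_sum -sumrB big_seq
    [leRHS]big_seq.
  apply: ler_sum => p pp; rewrite -natr_sum -divn_count_dvd.
  by have [] := @divn_bounds R x p (prime_gt0 (aps _ pp)).
have h3 : \sum_(1 <= q < x.+1) (om q) ^+ 2 <= x%:R * W ^+ 2 + x%:R * W.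
  have -> : \sum_(1 <= q < x.+1) (om q) ^+ 2 =
     \sum_(p <- ps) \sum_(p' <- ps) \sum_(1 <= q < x.+1) (p %| q)%:R
       * (p' %| q)%:R.
    under [RHS]eq_bigr do rewrite exchange_big.
    rewrite exchange_big /=; apply: eq_bigr => q _.
    by rewrite expr2 {1}/om mulr_suml; apply: eq_bigr => p _;
      rewrite /om mulr_sumr.
  have -> : x%:R * W ^+ 2 + x%:R * W =
     \sum_(p <- ps) \sum_(p' <- ps) (x%:R / (p%:R * p'%:R) + (p' == p)%:R
       * (x%:R / p%:R)).
    under [RHS]eq_bigr do rewrite big_split.
    rewrite big_split /=; congr (_ + _).
      rewrite expr2 mulrCA {1}/W mulr_suml; apply: eq_bigr => p _.
      rewrite mulrA /W mulr_sumr; apply: eq_bigr => p' _.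
      by rewrite invfM mulrA [X in X * _]mulrC.
    rewrite mulr_sumr big_seq [RHS]big_seq; apply: eq_bigr => p pp.
    rewrite -mulr_suml -natr_sum.
    have -> : (\sum_(p' <- ps) (p' == p) = 1)%N; last by rewrite mul1r.
    transitivity (count_mem p ps); last by rewrite count_uniq_mem // pp.
    by rewrite -sum1_count [RHS]big_mkcond; apply: eq_bigr => p' _ /=;
      case: (p' == p).
  rewrite big_seq [leRHS]big_seq; apply: ler_sum => p pp.
  rewrite big_seq [leRHS]big_seq; apply: ler_sum => p' pp'.
  have pr := aps _ pp; have pr' := aps _ pp'.
  under eq_bigr do rewrite -natrM mulnb.
  rewrite -natr_sum.
  have [->|neq] := eqVneq p' p.
    under eq_bigr do rewrite andbb.
    rewrite -divn_count_dvd mul1r.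
    have [_ h] := @divn_bounds R x p (prime_gt0 pr).
    by apply: le_trans h _; rewrite lerDr divr_ge0 // mulr_ge0.
  have cp : coprime p p' by rewrite prime_coprime // dvdn_prime2 // eq_sym.
  under eq_bigr do rewrite -Gauss_dvd //.
  rewrite -divn_count_dvd mul0r addr0 -natrM.
  by have [] := @divn_bounds R x (p * p')%N; rewrite // muln_gt0 !prime_gt0.
have h4 : A%:R * W ^+ 2 <= (x%:R + 2 * (size ps)%:R) * W.
  apply: (le_trans h1).
  under eq_bigr do rewrite sqrrB.
  rewrite big_split sumrB /= sumrMnl -mulr_suml sumr_const_nat subn1 /=
    -[_ *+ x]mulr_natl.
  have : x%:R * W - (size ps)%:R <= \sum_(1 <= q < x.+1) om q by [].
  move/(ler_wpM2r W0); move: h3.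
  set s2 := \sum_(1 <= q < x.+1) om q ^+ 2; set s1 := \sum_(1 <= q < x.+1) om q.
  move: (x%:R) (size ps)%:R => X n; clearbody s1 s2 W.
  by move=> h3 h5; rewrite -mulr_natl; nra.
have [W1|W1] := leP W 0.
  have -> : W = 0 by apply/eqP; rewrite eq_le W1.
  by rewrite mulr0 addr_ge0 // mulr_ge0.
by rewrite -(ler_pM2r W1) -mulrA -expr2.
Qed.

Lemma sum_inv_squares (R : realType) K L : (0 < K)%N ->
  \sum_(p <- primes_between K L) (p%:R ^+ 2)^-1 <= K%:R^-1 :> R.
Proof.
move=> K0; rewrite /primes_between big_filter.
have [LK|KL] := leqP L K; first by rewrite big_geq ?invr_ge0 // leqW.
apply: (@le_trans _ _ (\sum_(K.+1 <= p < L) (p.-1%:R^-1 - p%:R^-1))).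
  rewrite big_mkcond big_nat [leRHS]big_nat; apply: ler_sum => p /andP[Kp pL].
  have p1 : 0 < p.-1%:R :> R by rewrite ltr0n; lia.
  have p0 : 0 < p%:R :> R by rewrite ltr0n; lia.
  have pE : p%:R = p.-1%:R + 1 :> R by rewrite natr1 prednK //; lia.
  have -> : p.-1%:R^-1 - p%:R^-1 = (p.-1%:R * p%:R)^-1 :> R.
    by rewrite pE; field; rewrite -pE !gt_eqF.
  have h0 : 0 <= (p.-1%:R * p%:R)^-1 :> R by rewrite invr_ge0 mulr_ge0 // ltW.
  case: ifP => // _; rewrite lef_pV2 ?posrE ?exprn_gt0 ?mulr_gt0 // expr2.
  by apply: ler_wpM2r; [exact: ltW | rewrite [leRHS]pE lerDl].
have -> : \sum_(K.+1 <= p < L) (p.-1%:R^-1 - p%:R^-1) =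
  K%:R^-1 - L.-1%:R^-1 :> R.
  have LE : L = L.-1.+1 by lia.
  rewrite LE big_add1 /=.
  rewrite (eq_bigr (fun i : nat => - (i.+1%:R^-1 - i%:R^-1)));
    last by move=> i _; ring.
  rewrite sumrN (telescope_sumr (fun i : nat => i%:R^-1 : R)); last by lia.
  by rewrite opprB.
by rewrite gerBl invr_ge0.
Qed.

(** Among the multiples q of p, those with q / p in a given class modulo p are
    determined by the quotient of q by p^2. *)
Lemma count_multiple_residue x p a : (0 < p)%N ->
  (\sum_(1 <= q < x.+1) ((p %| q) && ((q %/ p) %% p == a)) <= x %/ (p * p)
    + 1)%N.
Proof.
move=> p0; rewrite addn1 -[leqRHS]card_ord.
apply: (@sum_pred_le_card _ _ _ (fun q => inord (q %/ (p * p))));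
  first exact: iota_uniq.
have pp0 : (0 < p * p)%N by rewrite muln_gt0 p0.
move=> q q'; rewrite !inE !mem_index_iota.
move=> /andP[/andP[_ qx] /andP[pq /eqP qa]]
  /andP[/andP[_ qx'] /andP[pq' /eqP qa']] /(congr1 val) /=.
rewrite !inordK ?ltnS ?leq_div2r // => h.
rewrite -(divnK pq) -(divnK pq') (divn_eq (q %/ p) p) (divn_eq (q' %/ p) p) qa
  qa'.
by rewrite -!divnMA h.
Qed.

(** A prime l is a good factor of q when it divides q exactly once and q / l is
    not in a bad residue class modulo l. *)
Definition good_factor (Bad : nat -> nat -> bool) q l :=
  [&& (l %| q)%N, ~~ (l %| q %/ l)%N & ~~ Bad l ((q %/ l) %% l)%N].

Lemma primes_betweenP K L p : p \in primes_between K L -> prime p /\ (K < p)%N.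
Proof. by rewrite mem_filter mem_index_iota => /and3P[]. Qed.

Lemma count_no_good_factor (R : realType) x K L
  (Bad : nat -> nat -> bool) (D : R) :
  (0 < K)%N -> 0 <= D ->
  (forall l, l \in primes_between K L -> (\sum_(1 <= a < l) Bad l a)%N%:R <= D)
    ->
  (\sum_(1 <= q < x.+1) ~~ has (good_factor Bad q) (primes_between K L))%N%:R <=
  (\sum_(1 <= q < x.+1) all (fun p => ~~ (p %| q)) (primes_between K L))%N%:R
  + (x%:R / K%:R + D * (x%:R / K%:R + (size (primes_between K L))%:R)) :> R.
Proof.
move=> K0 D0 hD; set ps := primes_between K L.
have h1 : (\sum_(1 <= q < x.+1) ~~ has (good_factor Bad q) ps <=
   \sum_(1 <= q < x.+1) all (fun p => ~~ (p %| q)) ps +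
   \sum_(l <- ps) (x %/ (l * l) + \sum_(1 <= a < l) Bad l a
     * (x %/ (l * l) + 1)))%N.
  apply: (@leq_trans (\sum_(1 <= q < x.+1) (all (fun p => ~~ (p %| q)) ps +
     \sum_(l <- ps) ((l * l %| q) + \sum_(1 <= a < l) Bad l a
       * ((l %| q) && ((q %/ l) %% l == a)))))%N).
    apply: leq_sum => q _.
    have [//|/hasPn ng] := boolP (has _ _).
    have [//|/allPn[l lps]] := boolP (all _ _).
    rewrite negbK => lq; rewrite add0n (big_rem l lps) /=.
    have [pl _] := primes_betweenP lps.
    have [h'|h'] := boolP (l %| q %/ l)%N.
      have -> : (l * l %| q)%N by rewrite -(divnK lq) dvdn_pmul2r ?prime_gt0.
      by rewrite -!addnA leq_addr.
    have := ng _ lps; rewrite /good_factor lq h' /= negbK => h.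
    rewrite (big_rem ((q %/ l) %% l)%N) /=; first by rewrite h eqxx; lia.
    by rewrite mem_index_iota lt0n h' ltn_pmod // prime_gt0.
  rewrite big_split /= leq_add2l exchange_big /= big_seq [leqRHS]big_seq;
    apply: leq_sum => l lps.
  have [pl _] := primes_betweenP lps.
  rewrite big_split /= -divn_count_dvd leq_add2l exchange_big /=.
  apply: leq_sum => a _; rewrite -big_distrr /= leq_mul2l.
  by rewrite count_multiple_residue ?orbT // prime_gt0.
move: h1; rewrite -(ler_nat R) natrD => h1; apply: (le_trans h1).
rewrite lerD2l natr_sum.
have h2 : \sum_(l <- ps) (x %/ (l * l) + \sum_(1 <= a < l) Bad l a
  * (x %/ (l * l) + 1))%N%:R
   <= \sum_(l <- ps) (x%:R * (l%:R ^+ 2)^-1 + D * (x%:R * (l%:R ^+ 2)^-1 + 1)).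
  rewrite big_seq [leRHS]big_seq; apply: ler_sum => l lps.
  have [pl _] := primes_betweenP lps.
  have ll0 : (0 < l * l)%N by rewrite muln_gt0 prime_gt0.
  have h : (x %/ (l * l))%:R <= x%:R * (l%:R ^+ 2)^-1 :> R.
    by rewrite expr2 -natrM ler_pdivlMr ?ltr0n // -natrM ler_nat leq_trunc_div.
  rewrite natrD; apply: lerD => //.
  rewrite -big_distrl /= natrM; apply: ler_pM => //; first exact: hD.
  by rewrite natrD lerD2r.
apply: (le_trans h2); rewrite big_split /= -mulr_sumr -mulr_sumr big_split /=
  -mulr_sumr.
have -> : \sum_(l <- ps) 1 = (size ps)%:R :> R by rewrite -sum1_size natr_sum.
have h3 : x%:R * \sum_(l <- ps) (l%:R ^+ 2)^-1 <= x%:R / K%:R :> R.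
  by rewrite ler_wpM2l // sum_inv_squares.
by rewrite lerD // ler_wpM2l // lerD.
Qed.

(** If the number of nonzero bad classes modulo l is bounded independently of
    l, then for a suitable range ]K, L[ the integers with no good prime factor
    in this range have upper density at most eta. The range and the threshold
    x0 do not depend on the bad classes. *)
Lemma few_without_good_factor (R : realType) (D eta : R) K0 : 0 <= D ->
  0 < eta ->
  exists K L x0, (K0 <= K)%N /\
  forall Bad : nat -> nat -> bool,
  (forall l, l \in primes_between K L -> (\sum_(1 <= a < l) Bad l a)%N%:R <= D)
    ->
  forall x, (x0 <= x)%N ->
  (\sum_(1 <= q < x.+1) ~~ has (good_factor Bad q) (primes_between K L))%N%:R <=
    eta * x%:R.
Proof.
move=> D0 eta0.
(* The choice of K bounds the contribution of the squares and of the bad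
   classes by eta x / 3, that of L the integers with no prime factor in the
   range; the bounded terms fit in the last third for large x. *)
pose K := (K0 + (Num.truncn (3 * (1 + D) / eta)).+1)%N.
have Kpos : (0 < K)%N by rewrite /K addnS.
have Kr : 3 * (1 + D) / eta <= K%:R.
  apply: ltW; apply: lt_le_trans (truncnS_gt _) _.
  by rewrite ler_nat leq_addl.
have [L KL hL] := prime_reciprocals_diverge R K (2 * (Num.truncn (3 / eta)).+1).
set ps := primes_between K L in hL.
set W := \sum_(p <- ps) p%:R^-1 in hL.
have Wr : 3 / eta <= W.
  apply: le_trans hL; rewrite natrM mulrAC divff // mul1r.
  exact: ltW (truncnS_gt _).
have W0 : 0 < W by apply: lt_le_trans Wr; rewrite divr_gt0.
set n := (size ps)%:R : R.
pose c := 2 * n / W + D * n.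
pose x0 := (Num.truncn (3 * c / eta)).+1.
exists K, L, x0; split; first by rewrite leq_addr.
move=> Bad hB x hx.
have xr : 3 * c / eta <= x%:R.
  by apply: ltW; apply: lt_le_trans (truncnS_gt _) _; rewrite ler_nat.
have := count_no_good_factor x Kpos D0 hB; rewrite -/ps -/n => h;
  apply: (le_trans h).
have pr : all prime ps by apply/allP => p /primes_betweenP[].
have up : uniq ps by rewrite filter_uniq // iota_uniq.
have := turan R x up pr; rewrite -/W -/n.
set A := (\sum_(1 <= q < x.+1) _)%N%:R => hA.
have hA2 : A <= (x%:R + 2 * n) / W by rewrite ler_pdivlMr.
have K0' : 0 < K%:R :> R by rewrite ltr0n.
have xx : 0 <= x%:R :> R by [].
have e1 : x%:R / W <= eta * x%:R / 3.
  rewrite ler_pdivrMr //; move: Wr; rewrite ler_pdivrMr // => Wr.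
  have := ler_wpM2l xx Wr; lra.
have e2 : (1 + D) * (x%:R / K%:R) <= eta * x%:R / 3.
  rewrite mulrA ler_pdivrMr //.
  move: Kr; rewrite ler_pdivrMr // => Kr.
  have := ler_wpM2r xx Kr; lra.
have e3 : c <= eta * x%:R / 3.
  by move: xr; rewrite ler_pdivrMr // => ?; lra.
have : (x%:R + 2 * n) / W = x%:R / W + 2 * n / W by rewrite mulrDl.
by rewrite /c in e3; lra.
Qed.

(** * Counting coprime pairs *)

Lemma sum_coprime_pairs (V : nmodType) n (F : nat -> nat -> V) :
  \sum_(z in coprime_pairs n) F z.1 z.2 =
  \sum_(1 <= q < n.+1) \sum_(1 <= p < q | coprime p q) F p q.
Proof.
transitivity (\sum_(q < n.+1) \sum_(p < n.+1 | (0 < p < q)%N && coprime p q) F p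
  q).
  rewrite (exchange_big_dep xpredT) //= pair_big_dep /=.
  by apply: eq_bigl => -[p q]; rewrite inE.
rewrite -(big_mkord xpredT
  (fun q => \sum_(p < n.+1 | (0 < p < q)%N && coprime p q) F p q)).
rewrite big_ltn //= big1 ?add0r; last by move=> p; rewrite ltn0 andbF.
rewrite !big_nat; apply: eq_bigr => q /andP[q0 qn].
rewrite -(big_mkord (fun p => (0 < p < q)%N && coprime p q) (F^~ q)).
rewrite big_ltn_cond //= (big_cat_nat (n := q)) //=; last exact: ltnW.
rewrite [X in _ + X]big_nat_cond [X in _ + X]big1 ?addr0; last first.
  move=> p /andP[/andP[qp _] /andP[/andP[_ pq] _]].
  by rewrite ltnNge qp in pq.
rewrite big_nat_cond [RHS]big_nat_cond; apply: eq_bigl => p.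
by case: ltnP => //= h; case: ltnP.
Qed.

Lemma card_coprime_pairs n :
  #|coprime_pairs n| = (\sum_(1 <= q < n.+1) \sum_(1 <= p < q) coprime p q)%N.
Proof.
rewrite -sum1_card (@sum_coprime_pairs nat n (fun _ _ => 1%N)).
by apply: eq_bigr => q _; rewrite [LHS]big_mkcond; apply: eq_bigr => p _;
  case: coprime.
Qed.

(** The pairs that are not coprime have a common prime factor, so that in the
    square of side n they are at most (1/4 + 1/2) n^2. *)
Lemma card_coprime_pairs_ge (R : realType) n : (3 <= n)%N ->
  n%:R ^+ 2 / 16 <= #|coprime_pairs n|%:R :> R.
Proof.
move=> n3; set P := #|_|.
have n1 : (1 < n.+1)%N by rewrite ltnS; apply: ltn_trans n3.
pose S := (\sum_(1 <= a < n.+1) \sum_(1 <= b < n.+1) coprime a b)%N.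
(* By symmetry, the coprime points of the square are those below the diagonal,
   counted twice, and the point (1, 1). *)
have hSP : (S <= 2 * P + 1)%N.
  have -> : S =
    (\sum_(1 <= a < n.+1) \sum_(1 <= b < n.+1) (coprime a b * (a < b)) +
     \sum_(1 <= a < n.+1) \sum_(1 <= b < n.+1) (coprime a b * (b < a)) +
     \sum_(1 <= a < n.+1) \sum_(1 <= b < n.+1) (coprime a b * (a == b)))%N.
    rewrite -!big_split /=; apply: eq_bigr => a _; rewrite -!big_split /=;
      apply: eq_bigr => b _.
    by case: ltngtP; lia.
  have hP : P =
    (\sum_(1 <= a < n.+1) \sum_(1 <= b < n.+1) (coprime a b * (b < a)))%N.
    rewrite /P card_coprime_pairs !big_nat; apply: eq_bigr => q /andP[q0 qn].
    rewrite [RHS](big_cat_nat (n := q)) //=; last exact: ltnW.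
    rewrite [X in _ = (_ + X)%N]big_nat_cond [X in _ = (_ + X)%N]big1 ?addn0;
      last first.
      by move=> p /andP[/andP[h _] _]; rewrite ltnNge h muln0.
    rewrite !big_nat; apply: eq_bigr => p /andP[_ ->]; rewrite muln1.
    by rewrite coprime_sym.
  rewrite -hP exchange_big /=.
  have -> : (\sum_(1 <= j < n.+1) \sum_(1 <= i < n.+1) coprime i j * (i < j) =
    P)%N.
    by rewrite hP; apply: eq_bigr => a _; apply: eq_bigr => b _;
      rewrite coprime_sym.
  rewrite mul2n -addnn leq_add2l.
  apply: (@leq_trans (\sum_(1 <= a < n.+1) (a == 1))%N).
    rewrite !big_nat; apply: leq_sum => a /andP[a0 an].
    have [->|a1] := eqVneq a 1%N.
      rewrite (big_ltn n1) big_nat_cond big1 ?addn0 //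
        => b /andP[/andP[b1 _] _].
      by rewrite (ltn_eqF b1) muln0.
    rewrite leqn0 big1 // => b _; case: eqP => [<-|]; rewrite ?muln0 // muln1.
    by rewrite /coprime gcdnn (negPf a1).
  rewrite (big_ltn n1) eqxx big_nat_cond big1 // => a /andP[/andP[a1 _] _].
  by rewrite gtn_eqF.
have hS : (n * n <= S + ((n %/ 2) * (n %/ 2)
  + \sum_(p <- primes_between 2 n.+1) (n %/ p) * (n %/ p)))%N.
  have -> : (\sum_(p <- primes_between 2 n.+1) (n %/ p) * (n %/ p) =
    \sum_(1 <= a < n.+1) \sum_(1 <= b < n.+1) \sum_(p <- primes_between 2 n.+1)
      (p %| a) * (p %| b))%N.
    under [RHS]eq_bigr do rewrite exchange_big.
    rewrite exchange_big /=; apply: eq_bigr => p _.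
    rewrite !divn_count_dvd big_distrl /=; apply: eq_bigr => a _.
    by rewrite big_distrr.
  have -> : ((n %/ 2) * (n %/ 2) = \sum_(1 <= a < n.+1) \sum_(1 <= b < n.+1)
    (2 %| a) * (2 %| b))%N.
    rewrite !divn_count_dvd big_distrl /=; apply: eq_bigr => a _.
    by rewrite big_distrr.
  have -> : (n * n = \sum_(1 <= a < n.+1) \sum_(1 <= b < n.+1) 1)%N.
    by rewrite !sum_nat_const_nat !subn1 !muln1.
  rewrite /S -!big_split /= !big_nat; apply: leq_sum => a /andP[a0 an].
  rewrite -!big_split /= !big_nat; apply: leq_sum => b /andP[b0 bn].
  have [//|cab] := boolP (coprime a b).
  have g1 : (1 < gcdn a b)%N by rewrite ltn_neqAle eq_sym cab gcdn_gt0 a0.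
  pose p := pdiv (gcdn a b).
  have pp : prime p by apply: pdiv_prime.
  have pa : (p %| a)%N by apply: dvdn_trans (pdiv_dvd _) (dvdn_gcdl _ _).
  have pb : (p %| b)%N by apply: dvdn_trans (pdiv_dvd _) (dvdn_gcdr _ _).
  have [p2|p2] := eqVneq p 2; first by rewrite p2 in pa pb; rewrite pa pb.
  rewrite (big_rem p) /=; first by rewrite pa pb; lia.
  rewrite mem_filter pp mem_index_iota ltn_neqAle eq_sym p2 prime_gt1 //= ltnS.
  by apply: leq_trans (dvdn_leq a0 pa) _; rewrite -ltnS.
have n0 : 0 <= n%:R :> R by [].
have sq d : (0 < d)%N -> ((n %/ d) * (n %/ d))%:R <=
  n%:R ^+ 2 * (d%:R ^+ 2)^-1 :> R.
  move=> d0; have [_ h] := @divn_bounds R n d d0.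
  by rewrite natrM -exprVn -exprMn expr2 ler_pM.
have h4 : ((n %/ 2) * (n %/ 2) + \sum_(p <- primes_between 2 n.+1) (n %/ p)
  * (n %/ p))%N%:R <= n%:R ^+ 2 * (3 / 4) :> R.
  rewrite natrD natr_sum.
  have h5 := sq 2 isT.
  have h6 : \sum_(p <- primes_between 2 n.+1) ((n %/ p) * (n %/ p))%:R <=
    n%:R ^+ 2 * 2^-1 :> R.
    apply: (@le_trans _ _ (n%:R ^+ 2
      * \sum_(p <- primes_between 2 n.+1) (p%:R ^+ 2)^-1)).
      rewrite mulr_sumr big_seq [leRHS]big_seq;
        apply: ler_sum => p /primes_betweenP[pp _].
      by rewrite sq // prime_gt0.
    by rewrite ler_wpM2l ?sqr_ge0 // (@sum_inv_squares R 2).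
  apply: le_trans (lerD h5 h6) _; rewrite -mulrDr.
  by rewrite ler_wpM2l ?sqr_ge0 //; lra.
have : (n * n)%:R <= (2 * P + 1)%:R + n%:R ^+ 2 * (3 / 4) :> R.
  have hSP' : S%:R <= (2 * P + 1)%:R :> R by rewrite ler_nat.
  apply: le_trans (lerD hSP' h4).
  by rewrite -natrD ler_nat; apply: leq_trans hS _; rewrite leq_add2l.
rewrite natrD !natrM -expr2.
have n3' : 3 <= n%:R :> R by rewrite ler_nat.
by move=> h; nra.
Qed.

(** * Weyl sums over all pairs *)

Lemma Fp_int_neq0 l (z : int) : prime l -> z != 0 -> (`|z| < l)%N ->
  (z%:~R : 'F_l) != 0.
Proof.
move=> pl z0 zl; have h n : (0 < n < l)%N -> (n%:R : 'F_l) != 0.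
  by move=> /andP[n0 nl]; rewrite Fp_nat_eq0 // gtnNdvd.
case: z z0 zl => n n0 nl; first by rewrite -pmulrn h // nl andbT lt0n.
by rewrite NegzE rmorphN /= oppr_eq0 -pmulrn h.
Qed.

Lemma phase_freq_mod N l r : prime l ->
  phase_freq N l (r %% l) = phase_freq N l r.
Proof.
move=> pl; rewrite /phase_freq; congr (_ * _)^-1.
by apply: val_inj; rewrite /= !val_Fp_nat // modn_mod.
Qed.

Lemma totient_le n : (totient n <= n)%N.
Proof.
rewrite totient_count_coprime; apply: (@leq_trans (\sum_(0 <= d < n) 1)%N).
  by apply: leq_sum => d _; case: coprime.
by rewrite sum_nat_const_nat subn0 muln1.
Qed.

(** The Weyl sums over all pairs are small compared with the number of
    pairs. *)
Lemma weyl_sum_small (R : realType) (i j : nat) (m1 m2 : int) (e : R) :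
  (0 < i)%N -> (0 < j)%N -> ~~ odd (i + j) -> (m1 != 0) || (m2 != 0) -> 0 < e ->
  exists n0, forall n, (n0 <= n)%N ->
  `|\sum_(1 <= q < n.+1) \sum_(1 <= p < q | coprime p q) expi
    (weyl_phase R m1 m2 i j p q)|
  <= (e * (#|coprime_pairs n|)%:R)%:C%C.
Proof.
move=> i0 j0 No m0 e0.
(* The good q and the exceptional q contribute at most d n^2 each, and there
   are at least n^2 / 16 pairs. *)
pose d : R := e / 32.
have d0 : 0 < d by rewrite divr_gt0.
pose N := (i + j)%N.
have N0 : (0 < N)%N by rewrite /N addn_gt0 i0.
pose Bad l a := ~~ (`|expsum R (@phase_poly m1 m2 i j l) (phase_freq N l a)| <=
  (d * l.-1%:R)%:C%C).
pose D : R := 2 * N%:R / d ^+ 2.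
have D0 : 0 <= D by rewrite divr_ge0 ?exprn_ge0 ?mulr_ge0 // ltW.
pose z1 := m1 * denq (bern N) * N%:Z.
pose z2 := m2 * (dedekind_scale i j)%:Z * numq (bern N).
pose z3 := z2 * j%:Z.
(* Beyond K0 the Laurent polynomial is not constant modulo l, and l does not
   divide N. *)
pose K0 := (N.+1 + absz z1 + absz z3)%N.
have [K [L [x0 [KK0 hcount]]]] := few_without_good_factor K0 D0 d0.
have lK l : l \in primes_between K L ->
  [/\ prime l, (N.+1 < l)%N, (`|z1| < l)%N & (`|z3| < l)%N].
  move=> /primes_betweenP[pl Kl]; have := leq_ltn_trans KK0 Kl;
    rewrite /K0 => h.
  split=> //; apply: leq_ltn_trans h.
  - by rewrite -addnA leq_addr.
  - by rewrite addnAC leq_addl.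
  - by rewrite leq_addl.
have hcoef l : l \in primes_between K L ->
    phase_coef2 m2 i j l * j%:R != 0 \/ phase_coef2 m2 i j l =
      0 /\ phase_coef1 m1 N l != 0.
  move=> /lK[pl _ h1 h2].
  have B0 : bern N != 0 by exact: bern_even_neq0.
  have [m20|m20] := eqVneq m2 0; [right|left].
    split; first by rewrite /phase_coef2 m20 !mul0r.
    apply: Fp_int_neq0 => //; rewrite m20 eqxx orbF in m0.
    by rewrite !mulf_neq0 // ?denq_neq0 // -lt0n.
  have -> : phase_coef2 m2 i j l * j%:R = z3%:~R by rewrite intrM.
  apply: Fp_int_neq0 => //.
  by rewrite !mulf_neq0 // -?lt0n ?dedekind_scale_gt0 // numq_eq0.
have hBad l : l \in primes_between K L -> (\sum_(1 <= a < l) Bad l a)%N%:R <= D.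
  move=> lps; have [pl Nl h1 h2] := lK _ lps.
  apply: le_trans (@card_bad_expsum R l (@phase_poly m1 m2 i j l) N d pl d0 _);
    last first.
    by move=> c; apply: card_laurent_fiber => //; exact: hcoef.
  rewrite ler_nat; apply: (@sum_pred_le_card_in _ _ _ _ (phase_freq N l));
    first exact: iota_uniq.
    by move=> a _ ba; rewrite inE.
  have nz : ((denq (bern N))%:~R * N%:R : 'F_l) != 0.
    rewrite mulf_neq0 //; last by rewrite Fp_nat_eq0 // gtnNdvd // ltnW.
    have := bern_localized_large pl Nl;
      rewrite unfold_in /localized prime_coprime //.
    by rewrite -(Fp_nat_eq0 _ pl) pmulrn gez0_abs ?denq_ge0.
  move=> a b; rewrite !inE !mem_index_iota
    => /andP[/andP[_ al] _] /andP[/andP[_ bl] _].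
  move/invr_inj/(mulfI nz)/(congr1 val); rewrite /= !val_Fp_nat //.
  by rewrite !modn_small.
exists (maxn x0 3) => n; rewrite geq_max => /andP[xn n3].
pose ng q := ~~ has (good_factor Bad q) (primes_between K L).
have hq q : (1 <= q < n.+1)%N ->
   `|\sum_(1 <= p < q | coprime p q) expi (weyl_phase R m1 m2 i j p q)| <=
   (d * n%:R + (ng q)%:R * n%:R)%:C%C.
  move=> /andP[q0 qn].
  have [/hasP[l lps /and3P[lq lql gl]]|hng] :=
    boolP (has (good_factor Bad q) (primes_between K L)).
    have [pl Nl _ _] := lK _ lps.
    rewrite /ng /good_factor (_ : has _ _ = true) /=; last first.
      by apply/hasP; exists l => //; rewrite /good_factor lq lql.
    rewrite mul0r addr0.
    pose r := (q %/ l)%N; have qE : q = (l * r)%N by rewrite mulnC divnK.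
    have r0 : (0 < r)%N by rewrite divn_gt0 ?prime_gt0 // dvdn_leq.
    have q1 : (1 < q)%N by apply: leq_trans (dvdn_leq q0 lq); rewrite prime_gt1.
    have := weyl_sum_local_bound R m1 m2 pl Nl r0 i0 j0 No lql.
    rewrite -/r -qE [X in `|X| <= _ -> _]big_ltn_cond //.
    rewrite (_ : coprime 0 q = false); last by rewrite /coprime gcd0n gtn_eqF.
    move/le_trans; apply.
    move: gl; rewrite /Bad negbK phase_freq_mod // => gl.
    apply: (le_trans (ler_wpM2l _ gl)); first by rewrite ler0n.
    rewrite -(rmorph_nat (real_complex R)) -rmorphM /= lecR mulrCA;
      apply: ler_wpM2l; first exact: ltW.
    rewrite -natrM ler_nat; apply: (@leq_trans q); last by [].
    rewrite qE mulnC leq_mul ?totient_le //; exact: leq_pred.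
  rewrite /ng hng mul1r.
  apply: le_trans (ler_norm_sum _ _ _) _.
  under eq_bigr do rewrite norm_expi.
  apply: (@le_trans _ _ (n%:R)).
    rewrite big_mkcond; apply: (@le_trans _ _ (\sum_(1 <= p < q) 1)).
      by apply: ler_sum => p _; case: ifP.
    rewrite sumr_const_nat ler_nat; lia.
  rewrite -(rmorph_nat (real_complex R)) lecR lerDr mulr_ge0 // ltW //.
apply: le_trans (ler_norm_sum _ _ _) _.
apply: (@le_trans _ _ (\sum_(1 <= q < n.+1)
  (d * n%:R + (ng q)%:R * n%:R)%:C%C)).
  by rewrite big_nat [leRHS]big_nat; apply: ler_sum.
rewrite -rmorph_sum /= lecR big_split /= sumr_const_nat subn1 /= -mulr_suml
  -natr_sum.
have hc := hcount Bad hBad n xn.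
have hp := card_coprime_pairs_ge R n3.
have nn : 0 <= n%:R :> R by [].
have := ler_wpM2r nn hc.
rewrite -/ng.
set S := (\sum_(1 <= q < n.+1) _)%N%:R => hS.
have := ler_wpM2l (ltW e0) hp.
rewrite -[_ *+ n]mulr_natl /d in hS *.
move: hS; move: (#|_|%:R) => P hS hP.
by nra.
Qed.

(** * The Fejer kernel *)

(** The squared chordal distance |exp(2 pi i x) - 1|^2; it measures the
    distance of x to the integers. *)
Definition chord2 {R : realType} (x : R) : R := 2 - 2 * cos (pi *+ 2 * x).

Lemma norm_expi_sub1 (R : realType) (x : R) : `|expi x - 1| ^+ 2 =
  (chord2 x)%:C%C.
Proof.
rewrite -add_Re2_Im2 /expi /chord2 /= subr0; congr (_ %:C)%C.
by have := cos2Dsin2 (pi *+ 2 * x); lra.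
Qed.

Lemma chord2_ge0 (R : realType) (x : R) : 0 <= chord2 x.
Proof. by rewrite -ler0c -norm_expi_sub1 exprn_ge0. Qed.

Lemma chord2N (R : realType) (x : R) : chord2 (- x) = chord2 x.
Proof. by rewrite /chord2 mulrN cosN. Qed.

Lemma chord2_int (R : realType) (x : R) (m : int) : chord2 (x + m%:~R) =
  chord2 x.
Proof. by apply: complexI; rewrite -!norm_expi_sub1 expiD expi_int mulr1. Qed.

Lemma chord2_norm (R : realType) (x : R) : chord2 `|x| = chord2 x.
Proof. by case: (ger0P x) => // _; rewrite chord2N. Qed.

Lemma chord2_mono (R : realType) (x y : R) : 0 <= x -> x <= y -> y <= 2^-1 ->
  chord2 x <= chord2 y.
Proof.
move=> x0 xy y2; rewrite /chord2 lerD2l lerN2 ler_pM2l //.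
have p0 := @pi_gt0 R.
have itv z : 0 <= z -> z <= 2^-1 -> pi *+ 2 * z \in `[0, pi : R].
  move=> z0 z2; rewrite in_itv /=; apply/andP; split.
    by rewrite mulr_ge0 // mulrn_wge0 // ltW.
  rewrite -[pi *+ 2](mulr_natr pi 2) -mulrA -[leRHS]mulr1; apply: ler_wpM2l;
    [exact: ltW | lra].
rewrite leNgt ltr_cos ?itv //; [|lra|lra].
by rewrite -leNgt ler_wpM2l // mulrn_wge0 // ltW.
Qed.

Lemma chord2_gt0 (R : realType) (x : R) : 0 < x -> x <= 2^-1 -> 0 < chord2 x.
Proof.
move=> x0 x2; have p0 := @pi_gt0 R;
  rewrite /chord2 subr_gt0 -[ltRHS]mulr1 ltr_pM2l // -cos0.
have h1 : pi *+ 2 * x \in `[0, pi : R].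
  rewrite in_itv /=; apply/andP; split.
    by rewrite mulr_ge0 ?(ltW x0) // mulrn_wge0 // ltW.
  rewrite -[pi *+ 2](mulr_natr pi 2) -mulrA -[leRHS]mulr1; apply: ler_wpM2l;
    [exact: ltW | lra].
have h0 : 0 \in `[0, pi : R] by rewrite in_itv /= lexx ltW.
by rewrite (ltr_cos h0 h1) mulr_gt0 // mulrn_wgt0.
Qed.

Lemma chord2_gt0_lt1 (R : realType) (x : R) : 0 < x < 1 -> 0 < chord2 x.
Proof.
move=> /andP[x0 x1]; have [h|h] := leP x 2^-1; first exact: chord2_gt0.
rewrite -(chord2_int x (-1)) -chord2N; apply: chord2_gt0;
  rewrite ?rmorphN ?rmorph1; lra.
Qed.

Lemma expi_neq1 (R : realType) (x : R) : 0 < `|x| < 1 -> expi x != 1.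
Proof.
move=> /chord2_gt0_lt1 h; apply/eqP => e1.
have := norm_expi_sub1 x; rewrite e1 subrr normr0 expr0n /= => /complexI h0.
by rewrite chord2_norm -h0 ltxx in h.
Qed.

Lemma expiX (R : realType) (x : R) n : expi (n%:R * x) = expi x ^+ n.
Proof.
elim: n => [|n IH]; first by rewrite mul0r expi0.
by rewrite -natr1 mulrDl mul1r expiD IH exprSr.
Qed.

Lemma sum_expi_grid (R : realType) M (m : int) : (`|m| < M)%N ->
  \sum_(a < M) expi (m%:~R * (a%:R / M%:R) : R) = if m == 0 then M%:R else 0.
Proof.
move=> mM; have M0 : 0 < M%:R :> R by rewrite ltr0n; case: (M) mM.
have [->|m0] := eqVneq.
  under eq_bigr do rewrite mul0r expi0.
  by rewrite sumr_const card_ord.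
have t1 : expi (m%:~R / M%:R : R) != 1.
  apply: expi_neq1; rewrite normrM normfV (gtr0_norm M0) divr_gt0 ?normr_gt0
    ?intr_eq0 //=.
  by rewrite ltr_pdivrMr // mul1r -intr_norm -natr_absz ltr_nat.
have h : (expi (m%:~R / M%:R : R) - 1)
  * \sum_(a < M) expi (m%:~R / M%:R : R) ^+ a = 0.
  by rewrite -subrX1 -expiX mulrC divfK ?gt_eqF // expi_int subrr.
have -> : \sum_(a < M) expi (m%:~R * (a%:R / M%:R) : R) =
  \sum_(a < M) expi (m%:~R / M%:R : R) ^+ a.
  by apply: eq_bigr => a _; rewrite -expiX; congr expi; ring.
by move/eqP: h; rewrite mulf_eq0 subr_eq0 (negPf t1) => /eqP.
Qed.

(** The Fejer kernel, normalised to have mean value 1 / M over a period, so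
    that its translates by the multiples of 1 / M add up to 1. *)
Definition fejer {R : realType} M (x : R) : R :=
  complex.Re (`|\sum_(k < M) expi (k%:R * x)| ^+ 2) / M%:R ^+ 2.

Lemma fejerE (R : realType) M (x : R) :
  (fejer M x)%:C%C = `|\sum_(k < M) expi (k%:R * x)| ^+ 2 / M%:R ^+ 2.
Proof.
rewrite -[in RHS](@RRe_real _ (`|_| ^+ 2)); last by rewrite realX // normr_real.
by rewrite /fejer rmorphM fmorphV rmorphXn /= rmorph_nat.
Qed.

Lemma fejer_ge0 (R : realType) M (x : R) : 0 <= fejer M x.
Proof. by rewrite -ler0c fejerE divr_ge0 // exprn_ge0. Qed.

Lemma fejer_expansion (R : realType) M (x : R) :
  (fejer M x)%:C%C = \sum_(k < M) \sum_(l < M) expi ((k%:Z - l%:Z)%:~R * x)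
    / M%:R ^+ 2.
Proof.
rewrite fejerE sqr_normc rmorph_sum /= !mulr_suml; apply: eq_bigr => k _.
rewrite mulr_sumr mulr_suml; apply: eq_bigr => l _.
by rewrite intrB mulrBl expiD expiN.
Qed.

Lemma fejer_partition (R : realType) M (x : R) : (0 < M)%N ->
  \sum_(a < M) fejer M (x - a%:R / M%:R) = 1.
Proof.
move=> M0; have M0' : M%:R != 0 :> R[i] by rewrite pnatr_eq0 -lt0n.
apply: complexI; rewrite rmorph_sum /=.
under eq_bigr do rewrite fejer_expansion.
rewrite exchange_big /=.
transitivity (\sum_(k < M) (M%:R^-1 : R[i])); last first.
  by rewrite sumr_const card_ord -[M%:R^-1 *+ M]mulr_natl divff.
apply: eq_bigr => k _; rewrite exchange_big /= (bigD1 k) //= [X in _ + X]big1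
  ?addr0.
  under eq_bigr do rewrite subrr mul0r expi0.
  by rewrite sumr_const card_ord -[(_ / _) *+ M]mulr_natl mul1r expr2 invfM
    mulrA divff // mul1r.
move=> l lk; rewrite -mulr_suml.
have kl : k%:Z - l%:Z != 0.
  by rewrite subr_eq0 eqz_nat; apply: contraNneq lk => /val_inj ->.
have kM : (`|l%:Z - k%:Z| < M)%N.
  by have := ltn_ord k; have := ltn_ord l; lia.
have -> : \sum_(i < M) expi ((k%:Z - l%:Z)%:~R * (x - i%:R / M%:R)) =
   expi ((k%:Z - l%:Z)%:~R * x) * \sum_(i < M) expi
     ((l%:Z - k%:Z)%:~R * (i%:R / M%:R) : R).
  rewrite mulr_sumr; apply: eq_bigr => i _; rewrite -expiD; congr expi.
  by rewrite !intrB; ring.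
by rewrite sum_expi_grid // subr_eq0 eq_sym -subr_eq0 (negPf kl) mulr0 mul0r.
Qed.

(** The kernel is concentrated near the integers. *)
Lemma fejer_concentration (R : realType) M (x : R) :
  fejer M x * chord2 x <= 4 / M%:R ^+ 2.
Proof.
rewrite -lecR rmorphM /= fejerE -norm_expi_sub1 mulrAC -exprMn -normrM.
have -> : (\sum_(k < M) expi (k%:R * x)) * (expi x - 1) = expi (M%:R * x) - 1.
  rewrite expiX subrX1 mulrC; congr (_ * _); apply: eq_bigr => k _;
    exact: expiX.
rewrite rmorphM fmorphV rmorphXn /= !rmorph_nat.
rewrite ler_wpM2r ?invr_ge0 ?exprn_ge0 //.
have -> : (4 : R[i]) = 2 ^+ 2 by rewrite -natrX.
rewrite ler_pXn2r // ?nnegrE //.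
by apply: le_trans (ler_normB _ _) _; rewrite norm_expi normr1.
Qed.

(** * Continuous functions on the torus *)

Local Open Scope classical_set_scope.

Lemma torus_periodic (R : realType) (phi : R * R -> R) (x y : R) (m n : int) :
  torus_function phi -> phi (x + m%:~R, y + n%:~R) = phi (x, y).
Proof.
case=> _ p1 p2.
have h1 k a b : phi (a + k%:R, b) = phi (a, b).
  elim: k => [|k IH]; first by rewrite addr0.
  by rewrite -natr1 addrA p1.
have h2 k a b : phi (a, b + k%:R) = phi (a, b).
  elim: k => [|k IH]; first by rewrite addr0.
  by rewrite -natr1 addrA p2.
have g1 k a b : phi (a + k%:~R, b) = phi (a, b).
  case: k => k; first exact: h1.
  by rewrite NegzE rmorphN /= -pmulrn -(h1 k.+1 (a - _)) subrK.
have g2 k a b : phi (a, b + k%:~R) = phi (a, b).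
  case: k => k; first exact: h2.
  by rewrite NegzE rmorphN /= -pmulrn -(h2 k.+1 a (b - _)) subrK.
by rewrite g1 g2.
Qed.

(** The closed unit square. *)
Definition unit_square {R : realType} : set (R * R) := `[0, 1] `*` `[0, 1].

Lemma compact_unit_square (R : realType) : compact (@unit_square R).
Proof. by apply: compact_setX; exact: segment_compact. Qed.

Lemma unit_square_frac (R : realType) (x y : R) :
  unit_square (x - (Num.floor x)%:~R, y - (Num.floor y)%:~R).
Proof.
have h (z : R) : (`[0, 1] : set R) (z - (Num.floor z)%:~R).
  rewrite /= in_itv /= subr_ge0 floor_le /=.
  by have := floorD1_gt z; rewrite intrD /= => ?; lra.
by split; exact: h.
Qed.

(** Heine's theorem on the closed unit square, extended to the plane by
    periodicity. *)
Lemma torus_uniformly_continuous (R : realType) (phi : R * R -> R) (e : R) :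
  torus_function phi -> 0 < e ->
  exists2 d : R, 0 < d & forall x y x' y', `|x - x'| < d -> `|y - y'| < d ->
    `|phi (x, y) - phi (x', y')| < e.
Proof.
move=> tphi e0; have [cphi _ _] := tphi.
have /compact_near_coveringP cK := @compact_unit_square R.
pose Pr (d : R) (u : R * R) := forall v : R * R,
  `|u.1 - v.1| < d -> `|u.2 - v.2| < d -> `|phi u - phi v| < e.
(* By compactness, one d suits all the points of the square. *)
have : \forall d \near 0^'+, unit_square `<=` Pr d.
  apply: cK => u _.
  have e20 : 0 < e / 2 by rewrite divr_gt0.
  have /cvgr_dist_lt/(_ _ e20) := cphi u.
  rewrite -/(nbhs _ _) => /nbhs_ballP[r /= r0 hr].
  have r20 : 0 < r / 2 by rewrite divr_gt0.
  exists (ball u (r / 2), [set d : R | d < r / 2]) => /=.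
    by split; [exact: nbhsx_ballx | exact: nbhs_right_lt].
  move=> [u' d] /= [[b1 b2] dr] v h1 h2.
  rewrite /ball /= in b1 b2.
  have hu : `|phi u - phi u'| < e / 2.
    by apply: hr; split; rewrite /ball /=;
      [apply: lt_trans b1 _ | apply: lt_trans b2 _]; lra.
  have hv : `|phi u - phi v| < e / 2.
    apply: hr; split; rewrite /ball /=.
      have -> : u.1 - v.1 = (u.1 - u'.1) + (u'.1 - v.1) by ring.
      by apply: le_lt_trans (ler_normD _ _) _; lra.
    have -> : u.2 - v.2 = (u.2 - u'.2) + (u'.2 - v.2) by ring.
    by apply: le_lt_trans (ler_normD _ _) _; lra.
  have -> : phi u' - phi v = (phi u - phi v) - (phi u - phi u') by ring.
  by apply: le_lt_trans (ler_normB _ _) _; lra.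
move=> hd.
near (0 : R)^'+ => d.
exists d; first by near: d; exact: nbhs_right_gt.
move=> x y x' y' hx hy.
have hP : unit_square `<=` Pr d by near: d.
have := hP _ (unit_square_frac x y) (x' - (Num.floor x)%:~R,
  y' - (Num.floor y)%:~R).
rewrite /= -!rmorphN /= !torus_periodic //; apply.
  by rewrite rmorphN /= (_ : _ - _ = x - x') //; ring.
by rewrite rmorphN /= (_ : _ - _ = y - y') //; ring.
Unshelve. all: by end_near.
Qed.

Lemma chord2_small (R : realType) (d t : R) : 0 < d ->
  chord2 t < chord2 (Num.min d 2^-1) ->
  exists m : int, `|t - m%:~R| < d.
Proof.
move=> d0 ht; exists (Num.floor (t + 2^-1)).
set m := Num.floor _; set s := t - _.
have s2 : `|s| <= 2^-1.
  have h1 := floor_le (t + 2^-1); have h2 := floorD1_gt (t + 2^-1).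
  by rewrite intrD /= -/m in h1 h2; rewrite ler_norml /s; apply/andP; split;
    lra.
have md : 0 < Num.min d 2^-1 by rewrite lt_min d0 invr_gt0 ltr0n.
rewrite ltNge; apply/negP => sd.
have : chord2 (Num.min d 2^-1) <= chord2 `|s|.
  by apply: chord2_mono; rewrite ?(ltW md) // ge_min sd.
by rewrite chord2_norm /s -rmorphN chord2_int leNgt ht.
Qed.

(** Uniform continuity with respect to the chordal distance, which is the form
    that fits the concentration of the Fejer kernel. *)
Lemma torus_chord_continuous (R : realType) (phi : R * R -> R) (e : R) :
  torus_function phi -> 0 < e ->
  exists2 d : R, 0 < d & forall x y x' y', chord2 (x - x') < d ->
    chord2 (y - y') < d ->
    `|phi (x, y) - phi (x', y')| < e.
Proof.
move=> tphi e0; have [d d0 hd] := torus_uniformly_continuous tphi e0.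
have md : 0 < Num.min d 2^-1 by rewrite lt_min d0 invr_gt0 ltr0n.
exists (chord2 (Num.min d 2^-1)); first
  by rewrite chord2_gt0 // ge_min lexx orbT.
move=> x y x' y' /(chord2_small d0)[m hm] /(chord2_small d0)[n hn].
rewrite -(torus_periodic x' y' m n tphi); apply: hd.
  by rewrite opprD addrA.
by rewrite opprD addrA.
Qed.

Lemma torus_bounded (R : realType) (phi : R * R -> R) : torus_function phi ->
  exists2 B : R, 0 < B & forall u, `|phi u| <= B.
Proof.
move=> tphi; have [cphi _ _] := tphi.
have /ex_strict_bound_gt0[B B0 /= hB] : bounded_set (phi @` unit_square).
  apply: compact_bounded; apply: continuous_compact;
    last exact: compact_unit_square.
  exact: continuous_subspaceT.
exists B => // -[x y].
rewrite -(torus_periodic x y (- Num.floor x) (- Num.floor y) tphi) !rmorphN /=.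
by apply/ltW/hB; exists (x - (Num.floor x)%:~R, y - (Num.floor y)%:~R) => //;
  exact: unit_square_frac.
Qed.

(** * From Weyl sums to grid averages *)

Local Close Scope classical_set_scope.

(** The average of phi over the points of the torus with coordinates in (1/M)
    Z. *)
Definition grid_average {R : realType} (phi : R * R -> R) M : R :=
  (\sum_(a < M) \sum_(b < M) phi (a%:R / M%:R, b%:R / M%:R)) / M%:R ^+ 2.

(** The trigonometric polynomial obtained by convolution of the Fejer kernel,
    in each variable, with the values of phi on the grid. *)
Definition fejer_mean {R : realType} (phi : R * R -> R) M (u : R * R) : R :=
  \sum_(a < M) \sum_(b < M) phi (a%:R / M%:R, b%:R / M%:R) *
    (fejer M (u.1 - a%:R / M%:R) * fejer M (u.2 - b%:R / M%:R)).

Lemma fejer_mean_approx (R : realType) (phi : R * R -> R) (e : R) :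
  torus_function phi -> 0 < e ->
  exists2 M0, (0 < M0)%N & forall M, (M0 <= M)%N ->
    forall u, `|phi u - fejer_mean phi M u| <= e.
Proof.
move=> tphi e0; have e20 : 0 < e / 2 by rewrite divr_gt0.
have [d d0 hd] := torus_chord_continuous tphi e20.
have [B B0 hB] := torus_bounded tphi.
(* Where one of the chords is not small, the second term exceeds the
   oscillation 2 B of phi. *)
have hphi x y x' y' : `|phi (x, y) - phi (x', y')| <=
  e / 2 + 2 * B / d * (chord2 (x - x') + chord2 (y - y')).
  have c1 := chord2_ge0 (x - x'); have c2 := chord2_ge0 (y - y').
  have Bd : 0 < 2 * B / d by rewrite divr_gt0 // mulr_gt0.
  have big c c' : d <= c -> 0 <= c' ->
    `|phi (x, y) - phi (x', y')| <= e / 2 + 2 * B / d * (c + c').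
    move=> dc c'0; apply: (@le_trans _ _ (2 * B)).
      by apply: le_trans (ler_normB _ _) _; have := hB (x, y); have :=
        hB (x', y'); lra.
    have h : 2 * B <= 2 * B / d * c
      by rewrite mulrAC ler_pdivlMr // ler_wpM2l // mulr_ge0 // ltW.
    have := mulr_ge0 (ltW Bd) c'0; rewrite mulrDr; lra.
  have [h1|h1] := ltP (chord2 (x - x')) d; last exact: big.
  have [h2|h2] := ltP (chord2 (y - y')) d; last by rewrite [_ + chord2 _]addrC;
    exact: big.
  by apply: le_trans (ltW (hd _ _ _ _ h1 h2)) _; rewrite lerDl; apply: mulr_ge0;
    [exact: ltW | exact: addr_ge0].
pose c := 16 * B / d.
have c0 : 0 <= c by rewrite divr_ge0 ?mulr_ge0 // ltW.
exists (Num.truncn (2 * c / e)).+1 => // M hM [x y].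
have M0 : (0 < M)%N by apply: leq_trans hM.
have Mr : 0 < M%:R :> R by rewrite ltr0n.
have cM : c / M%:R <= e / 2.
  rewrite ler_pdivrMr //.
  have : 2 * c / e <= M%:R by apply: ltW (lt_le_trans (truncnS_gt _) _);
    rewrite ler_nat.
  by rewrite ler_pdivrMr // => ?; lra.
pose F (a : 'I_M) := fejer M (x - a%:R / M%:R).
pose G (b : 'I_M) := fejer M (y - b%:R / M%:R).
have F0 a : 0 <= F a by exact: fejer_ge0.
have G0 b : 0 <= G b by exact: fejer_ge0.
have F1 : \sum_a F a = 1 by exact: fejer_partition.
have G1 : \sum_b G b = 1 by exact: fejer_partition.
have conc (z : R) : \sum_(a < M) fejer M (z - a%:R / M%:R)
  * chord2 (z - a%:R / M%:R) <= 4 / M%:R.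
  apply: (@le_trans _ _ (\sum_(a < M) (4 / M%:R ^+ 2 : R))).
    by apply: ler_sum => a _; exact: fejer_concentration.
  rewrite sumr_const card_ord.
  have -> : (4 / M%:R ^+ 2) *+ M = 4 / M%:R :> R by rewrite -[LHS]mulr_natl;
    field; rewrite gt_eqF.
  by [].
have -> : phi (x, y) - fejer_mean phi M (x, y) =
    \sum_(a < M) \sum_(b < M) (phi (x, y) - phi (a%:R / M%:R, b%:R / M%:R))
      * (F a * G b).
  have e1 v : v = \sum_(a < M) \sum_(b < M) v * (F a * G b).
    transitivity (\sum_(a < M) v * F a); first by rewrite -mulr_sumr F1 mulr1.
    by apply: eq_bigr => a _; rewrite -!mulr_sumr G1 mulr1.
  rewrite [X in X - _]e1 /fejer_mean -sumrB; apply: eq_bigr => a _.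
  by rewrite -sumrB; apply: eq_bigr => b _; rewrite mulrBl.
apply: le_trans (ler_norm_sum _ _ _) _.
apply: (@le_trans _ _ (\sum_(a < M) \sum_(b < M) (e / 2 * (F a * G b) +
   2 * B / d * (F a * chord2 (x - a%:R / M%:R) * G b
     + F a * (G b * chord2 (y - b%:R / M%:R)))))).
  apply: ler_sum => a _; apply: le_trans (ler_norm_sum _ _ _) _.
  apply: ler_sum => b _; rewrite normrM (ger0_norm (mulr_ge0 (F0 a) (G0 b))).
  have := hphi x y (a%:R / M%:R) (b%:R / M%:R).
  move/(ler_wpM2r (mulr_ge0 (F0 a) (G0 b))) => h; apply: (le_trans h).
  by rewrite le_eqVlt; apply/orP; left; apply/eqP; ring.
pose X1 := \sum_(a < M) F a * chord2 (x - a%:R / M%:R).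
pose X2 := \sum_(b < M) G b * chord2 (y - b%:R / M%:R).
have h1 : X1 <= 4 / M%:R by exact: conc.
have h2 : X2 <= 4 / M%:R by exact: conc.
have -> : \sum_(a < M) \sum_(b < M) (e / 2 * (F a * G b) +
   2 * B / d * (F a * chord2 (x - a%:R / M%:R) * G b
     + F a * (G b * chord2 (y - b%:R / M%:R)))) =
   e / 2 + 2 * B / d * (X1 + X2).
  transitivity
    (\sum_(a < M) (e / 2 * F a + 2 * B / d
      * (F a * chord2 (x - a%:R / M%:R) + F a * X2))).
    apply: eq_bigr => a _; rewrite big_split -!mulr_sumr big_split -!mulr_sumr
      /=.
    by rewrite -/X2 G1 !mulr1.
  rewrite big_split /=; congr (_ + _); first by rewrite -mulr_sumr F1 mulr1.
  by rewrite -mulr_sumr big_split /= -[X in _ + X]mulr_suml F1 mul1r.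
have Bd : 0 <= 2 * B / d by rewrite divr_ge0 ?mulr_ge0 // ltW.
have := ler_wpM2l Bd (lerD h1 h2).
have -> : 2 * B / d * (4 / M%:R + 4 / M%:R) = c / M%:R by rewrite /c; field;
  rewrite !gt_eqF.
by move: cM; lra.
Qed.

(** The hypothesis of Weyl's criterion: for (m1, m2) other than (0, 0) the
    average of exp(2 pi i (m1 x + m2 y)) over the points (x, y) attached to the
    coprime pairs tends to 0. *)
Definition weyl_small {R : realType} (P : nat -> nat -> R * R) : Prop :=
  forall m1 m2 : int, (m1 != 0) || (m2 != 0) -> forall e : R, 0 < e ->
  exists n0, forall n, (n0 <= n)%N ->
  `|\sum_(z in coprime_pairs n) expi (m1%:~R * (P z.1 z.2).1
    + m2%:~R * (P z.1 z.2).2)|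
  <= (e * (#|coprime_pairs n|)%:R)%:C%C.

Lemma norm_real_complex (R : realType) (x : R) : `|x%:C%C| =
  (`|x|)%:C%C :> R[i].
Proof. by rewrite normc_def /= expr0n /= addr0 sqrtr_sqr. Qed.

(** Only the constant terms of the two kernels contribute to the average of
    their product over the points. *)
Lemma weyl_fejer (R : realType) (P : nat -> nat -> R * R) M (e : R) :
  weyl_small P -> (0 < M)%N -> 0 < e ->
  exists n0, forall n, (n0 <= n)%N -> forall x0 y0 : R,
  `|\sum_(z in coprime_pairs n) fejer M ((P z.1 z.2).1 - x0)
    * fejer M ((P z.1 z.2).2 - y0)
    - (#|coprime_pairs n|)%:R / M%:R ^+ 2| <= e * (#|coprime_pairs n|)%:R.
Proof.
move=> wP M0 e0.
have Mr : M%:R != 0 :> R[i] by rewrite pnatr_eq0 -lt0n.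
(* The indices t run over the terms of the product of the two expansions; those
   in diag have frequency (0, 0). *)
pose I := (('I_M * 'I_M) * ('I_M * 'I_M))%type.
pose d1 (t : I) : int := t.1.1%:Z - t.1.2%:Z.
pose d2 (t : I) : int := t.2.1%:Z - t.2.2%:Z.
pose diag (t : I) := (t.1.1 == t.1.2) && (t.2.1 == t.2.2).
have hd t : ~~ diag t -> (d1 t != 0) || (d2 t != 0).
  rewrite /diag negb_and /d1 /d2 !subr_eq0 !eqz_nat => /orP[h|h]; apply/orP;
    [left|right];
  by apply: contra h => /eqP/val_inj ->.
pose W n (t : I) := \sum_(z in coprime_pairs n) expi ((d1 t)%:~R * (P z.1 z.2).1
  + (d2 t)%:~R * (P z.1 z.2).2).
have /choice[f hf] : forall t, exists n0, ~~ diag t -> forall n, (n0 <= n)%N ->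
    `|W n t| <= (e * (#|coprime_pairs n|)%:R)%:C%C.
  move=> t; have [dt|/hd h] := boolP (diag t); first by exists 0%N.
  by have [n0 hn0] := wP _ _ h e e0; exists n0.
exists (\max_t f t) => n hn x0 y0.
set A := coprime_pairs n.
have hW t : ~~ diag t -> `|W n t| <= (e * (#|A|)%:R)%:C%C.
  by move=> dt; apply: hf => //; apply: leq_trans hn; exact: leq_bigmax.
pose c (t : I) : R[i] := expi (- ((d1 t)%:~R * x0 + (d2 t)%:~R * y0)).
have kE x y : (fejer M (x - x0) * fejer M (y - y0))%:C%C =
   \sum_(t : I) c t * expi ((d1 t)%:~R * x + (d2 t)%:~R * y) / M%:R ^+ 4.
  rewrite rmorphM /= !fejer_expansion !pair_big /= big_distrlr /= pair_big /=.
  apply: eq_bigr => t _; rewrite mulf_div -expiD /c -expiD -exprD;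
    congr (_ / _).
  by congr expi; rewrite /d1 /d2; ring.
have card_diag : \sum_(t : I) (diag t)%:R = M%:R ^+ 2 :> R[i].
  have h1 : \sum_(p : 'I_M * 'I_M) (p.1 == p.2)%:R = M%:R :> R[i].
    rewrite -(pair_big xpredT xpredT (fun k l : 'I_M => (k == l)%:R)) /=.
    transitivity (\sum_(k < M) (1 : R[i])); last by rewrite sumr_const card_ord.
    apply: eq_bigr => k _; rewrite (bigD1 k) //= eqxx big1 ?addr0 // => l lk.
    by rewrite eq_sym (negPf lk).
  rewrite expr2 -[in RHS]h1 big_distrlr /= pair_big /=.
  by apply: eq_bigr => t _; rewrite /diag -mulnb natrM.
rewrite -lecR -norm_real_complex rmorphB rmorph_sum /= rmorphM fmorphV rmorphXn
  /= !rmorph_nat.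
under eq_bigr do rewrite kE.
rewrite exchange_big /=.
have -> : (#|A|)%:R / M%:R ^+ 2 = \sum_(t : I) (diag t)%:R * (#|A|)%:R
  / M%:R ^+ 4 :> R[i].
  by rewrite -!mulr_suml card_diag; field.
rewrite -sumrB; apply: le_trans (ler_norm_sum _ _ _) _.
apply: (@le_trans _ _ (\sum_(t : I) (e * (#|A|)%:R)%:C%C / M%:R ^+ 4));
  last first.
  rewrite sumr_const !card_prod card_ord -[X in X <= _]mulr_natl !natrM.
  by rewrite le_eqVlt; apply/orP; left; apply/eqP; field.
apply: ler_sum => t _.
have -> : \sum_(z in A) c t * expi ((d1 t)%:~R * (P z.1 z.2).1
  + (d2 t)%:~R * (P z.1 z.2).2) / M%:R ^+ 4
   = c t * W n t / M%:R ^+ 4 by rewrite -mulr_suml -mulr_sumr.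
rewrite -mulrBl normrM normfV normrX normr_nat ler_wpM2r ?invr_ge0 ?exprn_ge0
  //.
have [dt|dt] := boolP (diag t); last first.
  by rewrite mul0r subr0 normrM norm_expi mul1r hW.
have [z1 z2] : d1 t = 0 /\ d2 t = 0.
  by move: dt => /andP[/eqP h1 /eqP h2]; rewrite /d1 /d2 h1 h2 !subrr.
rewrite /c /W z1 z2 !mul0r addr0 oppr0 expi0 !mul1r.
under eq_bigr do rewrite !mul0r addr0 expi0.
rewrite sumr_const subrr normr0 ler0c mulr_ge0 // ltW //.
Qed.

Lemma weyl_grid (R : realType) (P : nat -> nat -> R * R) (phi : R * R ->
  R) (e : R) :
  weyl_small P -> torus_function phi -> 0 < e ->
  exists2 M0, (0 < M0)%N & forall M, (M0 <= M)%N ->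
    exists n0, forall n, (n0 <= n)%N ->
  `|\sum_(z in coprime_pairs n) phi (P z.1 z.2) - (#|coprime_pairs n|)%:R
    * grid_average phi M|
   <= e * (#|coprime_pairs n|)%:R.
Proof.
move=> wP tphi e0; have e20 : 0 < e / 2 by rewrite divr_gt0.
have [M0 M00 hM0] := fejer_mean_approx tphi e20.
have [B B0 hB] := torus_bounded tphi.
exists M0 => // M hM.
have Mpos : (0 < M)%N by apply: leq_trans hM.
have Mr : 0 < M%:R :> R by rewrite ltr0n.
pose d := e / 2 / (B * M%:R ^+ 2).
have d0 : 0 < d by rewrite divr_gt0 // mulr_gt0 // exprn_gt0.
have [n0 hn0] := weyl_fejer wP Mpos d0.
exists n0 => n /hn0; set A := coprime_pairs n => hn.
have h1 : `|\sum_(z in A) (phi (P z.1 z.2) - fejer_mean phi M (P z.1 z.2))| <=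
  e / 2 * (#|A|)%:R.
  apply: le_trans (ler_norm_sum _ _ _) _.
  apply: (@le_trans _ _ (\sum_(z in A) (e / 2)));
    first by apply: ler_sum => z _; exact: hM0.
  by rewrite sumr_const -[_ *+ _]mulr_natr.
have h2 : `|\sum_(z in A) fejer_mean phi M (P z.1 z.2)
  - (#|A|)%:R * grid_average phi M| <= e / 2 * (#|A|)%:R.
  have -> : \sum_(z in A) fejer_mean phi M (P z.1 z.2)
    - (#|A|)%:R * grid_average phi M =
    \sum_(a < M) \sum_(b < M) phi (a%:R / M%:R, b%:R / M%:R) *
     (\sum_(z in A) fejer M ((P z.1 z.2).1 - a%:R / M%:R)
       * fejer M ((P z.1 z.2).2 - b%:R / M%:R)
      - (#|A|)%:R / M%:R ^+ 2).
    rewrite /fejer_mean exchange_big /= /grid_average mulrCA mulr_suml -sumrB.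
    apply: eq_bigr => a _; rewrite exchange_big /= mulr_suml -sumrB.
    by apply: eq_bigr => b _; rewrite mulrBr mulr_sumr.
  apply: (@le_trans _ _ (\sum_(a < M) \sum_(b < M) B * (d * (#|A|)%:R))).
    apply: le_trans (ler_norm_sum _ _ _) _; apply: ler_sum => a _.
    apply: le_trans (ler_norm_sum _ _ _) _; apply: ler_sum => b _.
    by rewrite normrM ler_pM //; exact: hn.
  rewrite !sumr_const !card_ord -mulrnA -[_ *+ _]mulr_natl natrM /d.
  by rewrite le_eqVlt; apply/orP; left; apply/eqP; field; rewrite !gt_eqF.
rewrite sumrB in h1.
move: h1 h2; set X := \sum_(z in A) fejer_mean _ _ _; set Y :=
  \sum_(z in A) phi _.
move=> h1 h2; have -> : Y - (#|A|)%:R * grid_average phi M =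
  (Y - X) + (X - (#|A|)%:R * grid_average phi M) by ring.
by apply: le_trans (ler_normD _ _) _; lra.
Qed.

(** * Grid averages and the integral *)

Local Open Scope classical_set_scope.

(** A fundamental domain of the torus. *)
Definition half_open_square {R : realType} : set (R * R) := `[0, 1[ `*` `[0, 1[.

(** Lebesgue measure on the plane, as a product measure. *)
Definition plane_measure {R : realType} :=
  (@lebesgue_measure R \x @lebesgue_measure R)%E.

(** The cell of side 1 / M of the fundamental domain whose lower left corner is
    the grid point p / M. *)
Definition grid_cell {R : realType} M (p : 'I_M * 'I_M) : set (R * R) :=
  `[(p.1%:R / M%:R),
    (p.1.+1%:R / M%:R)[ `*` `[(p.2%:R / M%:R), (p.2.+1%:R / M%:R)[.

(** The step function that takes, on each cell, the value of phi at its lower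
    left corner. *)
Definition grid_step {R : realType} (phi : R * R -> R) M (z : R * R) : R :=
  \sum_(p : 'I_M * 'I_M) phi (p.1%:R / M%:R, p.2%:R / M%:R)
    * \1_(grid_cell p) z.

Lemma measurable_half_open_square (R : realType) : measurable
  (@half_open_square R).
Proof. by apply: measurableX; exact: measurable_itv. Qed.

Lemma measurable_grid_cell (R : realType) M (p : 'I_M * 'I_M) : measurable
  (@grid_cell R M p).
Proof. by apply: measurableX; exact: measurable_itv. Qed.

(** A point of [0, 1[ belongs to exactly one interval of the subdivision. *)
Lemma grid_floor (R : realType) M (x : R) : (0 < M)%N -> (`[0, 1[ : set R) x ->
  exists a : 'I_M, forall b : 'I_M,
    (`[(b%:R / M%:R), (b.+1%:R / M%:R)[ : set R) x <-> b = a.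
Proof.
move=> M0 /=; rewrite in_itv /= => /andP[x0 x1].
have Mr : 0 < M%:R :> R by rewrite ltr0n.
have xM0 : 0 <= x * M%:R by rewrite mulr_ge0 // ltW.
have aM : (Num.truncn (x * M%:R) < M)%N.
  rewrite -(ltr_nat R); apply: le_lt_trans (_ : x * M%:R < M%:R);
    first by rewrite truncn_le.
  by rewrite -[ltRHS]mul1r ltr_pM2r.
exists (Ordinal aM) => b; rewrite in_itv /= ler_pdivrMr // ltr_pdivlMr //.
split=> [h|->] /=; last by rewrite truncn_itv.
by apply: val_inj => /=; apply/esym; apply: truncn_def.
Qed.

Lemma grid_stepE (R : realType) (phi : R * R -> R) M (z : R * R) : (0 < M)%N ->
  half_open_square z -> exists p : 'I_M * 'I_M,
   grid_cell p z /\ grid_step phi M z = phi (p.1%:R / M%:R, p.2%:R / M%:R).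
Proof.
move=> M0 [/= hx hy].
have [a ha] := grid_floor M0 hx; have [b hb] := grid_floor M0 hy.
exists (a, b).
have cE p : grid_cell p z <-> p = (a, b).
  case: p => p1 p2; split=> [[/= /ha -> /hb ->] //|[-> ->]].
  by split; [apply/ha|apply/hb].
split; first exact/cE.
rewrite /grid_step (bigD1 (a, b)) //= big1 ?addr0.
  by rewrite indicE mem_set ?mulr1 //; apply/cE.
move=> p /eqP pab; rewrite indicE memNset ?mulr0 //.
by move/cE.
Qed.

Lemma grid_step_approx (R : realType) (phi : R * R -> R) (e : R) :
  torus_function phi -> 0 < e ->
  exists2 M0, (0 < M0)%N & forall M, (M0 <= M)%N ->
    forall z, half_open_square z ->
    `|phi z - grid_step phi M z| <= e.
Proof.
move=> tphi e0; have [d d0 hd] := torus_uniformly_continuous tphi e0.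
exists (Num.truncn d^-1).+1 => // M hM z hz.
have M0 : (0 < M)%N by apply: leq_trans hM.
have Mr : 0 < M%:R :> R by rewrite ltr0n.
have Md : M%:R^-1 < d.
  rewrite invf_plt ?posrE //; apply: lt_le_trans (truncnS_gt _) _.
  by rewrite ler_nat.
have [p [[/= h1 h2] ->]] := grid_stepE phi M0 hz.
have close (a : nat) (x : R) : a%:R / M%:R <= x < a.+1%:R / M%:R ->
  `|x - a%:R / M%:R| < d.
  move=> /andP[xa xb]; rewrite ger0_norm ?subr_ge0 //; apply: le_lt_trans Md.
  by rewrite -natr1 mulrDl mul1r in xb; lra.
case: z {hz} h1 h2 => x y /=; rewrite !in_itv /= => h1 h2.
by apply: ltW; apply: hd; apply: close.
Qed.

Lemma plane_measure_square (R : realType) : plane_measure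
  (@half_open_square R) = 1%E.
Proof.
pose I : set R := `[0, 1[.
have h : lebesgue_measure I = 1%E.
  by rewrite lebesgue_measure_itv /= lte_fin ltr01 oppr0 adde0.
transitivity (lebesgue_measure I * lebesgue_measure I)%E.
  by apply: product_measure1E; exact: measurable_itv.
by rewrite h mule1.
Qed.

Lemma measurable_grid_step (R : realType) (phi : R * R -> R) M D :
  measurable_fun D (grid_step phi M).
Proof.
apply: measurable_sum => p; apply: measurable_funM; first exact: measurable_cst.
by apply: measurable_indic; exact: measurable_grid_cell.
Qed.

(** On the fundamental domain, phi is the pointwise limit of its step
    functions, which are measurable for the product of the Borel
    sigma-algebras. *)
Lemma measurable_torus_function (R : realType) (phi : R * R -> R) :
  torus_function phi -> measurable_fun half_open_square phi.
Proof.
move=> tphi; apply/measurable_EFinP.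
apply: (emeasurable_fun_cvg (fun M z => (grid_step phi M z)%:E)).
  by move=> M; apply/measurable_EFinP; exact: measurable_grid_step.
move=> z hz; apply/cvg_EFin; first by near=> M.
apply/cvgrPdist_le => e e0.
have [M0 _ hM] := grid_step_approx tphi e0.
by exists M0 => // M /= MM; exact: hM.
Unshelve. all: by end_near.
Qed.

Lemma integrable_torus_function (R : realType) (phi : R * R -> R) :
  torus_function phi -> (@plane_measure R).-integrable half_open_square
    (EFin \o phi).
Proof.
move=> tphi; have [B B0 hB] := torus_bounded tphi.
apply: measurable_bounded_integrable.
- exact: measurable_half_open_square.
- by rewrite [ltLHS]plane_measure_square ltry.
- exact: measurable_torus_function.
- by exists B; split; [exact: num_real|move=> C BC z _ /=];
  apply: le_trans (hB z) (ltW BC).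
Qed.

Lemma integrable_cell (R : realType) M (p : 'I_M * 'I_M) :
  (@plane_measure R).-integrable half_open_square (EFin \o \1_(grid_cell p)).
Proof.
apply: measurable_bounded_integrable.
- exact: measurable_half_open_square.
- by rewrite [ltLHS]plane_measure_square ltry.
- by apply: measurable_indic; exact: measurable_grid_cell.
- exists 1; split; [exact: num_real|move=> C BC z _ /=];
  apply: le_trans (ltW BC).
  by rewrite indicE; case: (_ \in _); rewrite ?normr1 ?normr0.
Qed.

Lemma grid_cell_sub (R : realType) M (p : 'I_M * 'I_M) :
  @grid_cell R M p `&` half_open_square = grid_cell p.
Proof.
apply/setIidPl => -[x y] []; rewrite /= !in_itv /= => h1 h2.
have Mr : 0 < M%:R :> R by rewrite ltr0n (leq_ltn_trans _ (ltn_ord p.1)).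
have sub (a : 'I_M) (t : R) : a%:R / M%:R <= t < a.+1%:R / M%:R -> 0 <= t < 1.
  move=> /andP[ta tb]; apply/andP; split.
    by apply: le_trans ta; rewrite divr_ge0.
  by apply: lt_le_trans tb _; rewrite ler_pdivrMr // mul1r ler_nat.
by split; rewrite /= in_itv /=; [exact: sub h1 | exact: sub h2].
Qed.

Lemma integral_cell (R : realType) M (p : 'I_M * 'I_M) :
  (\int[plane_measure]_(z in half_open_square) (\1_(@grid_cell R M p) z)%:E)%E =
    ((M%:R ^+ 2)^-1)%:E.
Proof.
have Mr : 0 < M%:R :> R by rewrite ltr0n (leq_ltn_trans _ (ltn_ord p.1)).
rewrite integral_indic;
  [|exact: measurable_half_open_square | exact: measurable_grid_cell].
rewrite grid_cell_sub.
pose I (a : 'I_M) : set R := `[(a%:R / M%:R), (a.+1%:R / M%:R)[.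
have h a : lebesgue_measure (I a) = (M%:R^-1)%:E.
  rewrite lebesgue_measure_itv /= lte_fin ltr_pM2r ?invr_gt0 // ltr_nat ltnSn.
  by rewrite -EFinB -natr1 mulrDl mul1r addrAC subrr add0r.
transitivity (lebesgue_measure (I p.1) * lebesgue_measure (I p.2))%E.
  by apply: product_measure1E; exact: measurable_itv.
by rewrite !h -EFinM expr2 invfM.
Qed.

Lemma torus_integral_grid (R : realType) (phi : R * R -> R) (e : R) :
  torus_function phi -> 0 < e ->
  exists M0, forall M, (M0 <= M)%N ->
    `|torus_integral phi - grid_average phi M| <= e.
Proof.
move=> tphi e0; have [M0 M00 hM0] := grid_step_approx tphi e0.
exists M0 => M hM.
have iphi := integrable_torus_function tphi.
have mS := @measurable_half_open_square R.
have icell (p : 'I_M * 'I_M) : (@plane_measure R).-integrable half_open_square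
    (fun z => (phi (p.1%:R / M%:R, p.2%:R / M%:R))%:E
      * (\1_(grid_cell p) z)%:E)%E.
  by apply: integrableZl => //; exact: integrable_cell.
have stepE : EFin \o grid_step phi M = fun z => (\sum_(p : 'I_M * 'I_M)
    (phi (p.1%:R / M%:R, p.2%:R / M%:R))%:E * (\1_(grid_cell p) z)%:E)%E.
  by apply/funext => z; rewrite /= /grid_step -sumEFin.
have istep : (@plane_measure R).-integrable half_open_square
  (EFin \o grid_step phi M).
  rewrite stepE; apply: integrable_sum => [|p _]; [exact: mS | exact: icell].
have gridE : \int[plane_measure]_(z in half_open_square) grid_step phi M z =
  grid_average phi M.
  rewrite /Rintegral -[X in fine X]/(\int[plane_measure]_(z in half_open_square)
    (EFin \o grid_step phi M) z)%E.
  rewrite stepE integral_sum; [|exact: mS|exact: icell].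
  rewrite (eq_bigr (fun p : 'I_M * 'I_M
    => (phi (p.1%:R / M%:R, p.2%:R / M%:R) / M%:R ^+ 2)%:E)).
    by rewrite sumEFin /= -mulr_suml /grid_average pair_big.
  move=> p _; rewrite integralZl; [|exact: mS|exact: integrable_cell].
  by rewrite [X in (_ * X)%E]integral_cell EFinM.
have ie : (@plane_measure R).-integrable half_open_square (EFin \o (fun=> e)).
  apply: measurable_bounded_integrable.
  - exact: measurable_half_open_square.
  - by rewrite [ltLHS]plane_measure_square ltry.
  - exact: measurable_cst.
  - by exists `|e|; split; [exact: num_real|move=> C eC z _ /=; exact: ltW].
have idiff : (@plane_measure R).-integrable half_open_square
  (EFin \o (fun z => phi z - grid_step phi M z)).
  by apply: (integrableB _ iphi istep); exact: mS.
rewrite -gridE /torus_integral -/plane_measure -/half_open_square.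
have -> : \int[plane_measure]_(z in half_open_square) phi z -
    \int[plane_measure]_(z in half_open_square) grid_step phi M z =
    \int[plane_measure]_(z in half_open_square) (phi z - grid_step phi M z).
  by apply/esym; apply: (RintegralB _ iphi istep); exact: mS.
apply: le_trans (le_normr_Rintegral _ idiff) _; first exact: mS.
apply: (@le_trans _ _ (\int[plane_measure]_(z in half_open_square) e)).
  apply: (le_Rintegral _ _ ie); [exact: mS| |exact: hM0].
  by have := integrable_norm idiff.
rewrite Rintegral_cst; last exact: mS.
by rewrite [X in fine X]plane_measure_square mulr1.
Qed.

(** * Equidistribution *)

Local Close Scope classical_set_scope.

Lemma weyl_criterion (R : realType) (P : nat -> nat -> R * R) :
  weyl_small P -> equidistributed P.
Proof.
move=> wP phi tphi; apply/cvgrPdist_le => e e0.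
have e20 : 0 < e / 2 by rewrite divr_gt0.
have [M1 M10 hM1] := weyl_grid wP tphi e20.
have [M2 hM2] := torus_integral_grid tphi e20.
have [n0 hn0] := hM1 (maxn M1 M2) (leq_maxl _ _).
have := hM2 (maxn M1 M2) (leq_maxr _ _).
set g := grid_average _ _ in hn0 * => hg.
exists (maxn n0 3) => // n /=; rewrite geq_max => /andP[/hn0 hn n3].
have A0 : 0 < (#|coprime_pairs n|)%:R :> R.
  apply: lt_le_trans (card_coprime_pairs_ge R n3).
  by rewrite divr_gt0 // exprn_gt0 // ltr0n (leq_trans _ n3).
move: hn; set S := \sum_(z in _) _; move: A0; move: (#|_|%:R) => A A0 hn.
have h : `|S / A - g| <= e / 2.
  have -> : S / A - g = (S - A * g) / A by field; rewrite gt_eqF.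
  by rewrite normrM normfV (gtr0_norm A0) ler_pdivrMr.
have -> : torus_integral phi - S / A = (torus_integral phi - g) - (S / A - g)
  by ring.
by apply: le_trans (ler_normB _ _) _; lra.
Qed.

Lemma dedekind_points_weyl_small (R : realType) (i j : nat) :
  (0 < i)%N -> (0 < j)%N -> ~~ odd (i + j) ->
  weyl_small (fun p q : nat =>
    (fractional_part (p%:R / q%:R : R),
     fractional_part ((dedekind_scale i j)%:R * q%:R ^+ (i + j - 2)%N
                      * dedekind_sum i j p q : R))).
Proof.
move=> i0 j0 No m1 m2 m0 e e0.
have [n0 hn0] := weyl_sum_small i0 j0 No m0 e0.
exists n0 => n /hn0;
  rewrite -(@sum_coprime_pairs _ n (fun p q
    => expi (weyl_phase R m1 m2 i j p q))).
apply: le_trans; rewrite le_eqVlt; apply/orP; left; apply/eqP; congr `|_|.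
by apply: eq_bigr => z _;
  rewrite /= expi_fractional_part addrC expi_fractional_part addrC.
Qed.

Unset Implicit Arguments.

Theorem theorem1p3 (R : realType) (i j : nat)
    (i_gt0 : (0 < i)%N) (j_gt0 : (0 < j)%N) (N_even : ~~ odd (i + j)%N) :
  equidistributed (fun p q : nat =>
    (fractional_part (p%:R / q%:R : R),
     fractional_part ((dedekind_scale i j)%:R * q%:R ^+ (i + j - 2)%N
                      * dedekind_sum i j p q : R))).
Proof. by apply: weyl_criterion; exact: dedekind_points_weyl_small. Qed.
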